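(* Let $p>3$ be prime, $0\le m\le p-1$, and let $A=\begin{pmatrix} a&k\\ p&d\end{pmatrix}\in\Gamma_0(p)$ with $1\le a,d\le p-1$. Then $$\big(\mathcal{K}^{(C)}_{p,m}(\zeta_p,z)\big)\big|[A]_1=\frac{\sin(\pi/p)}{\sin(d\pi/p)}\,(-1)^{d+1}\,\zeta_p^{mak}\,\mathcal{K}^{(C)}_{p,ma^2}(\zeta_p^{d},z).$$
   Context: $z$ in the upper half-plane, $q=e^{2\pi i z}$, $q^r=e^{2\pi i r z}$, $\zeta_p=e^{2\pi i/p}$, $(a;q)_\infty=\prod_{k\ge0}(1-aq^k)$; $(F|[A]_1)(z)=(cz+d)^{-1}F\big(\tfrac{az+b}{cz+d}\big)$ for $A=\begin{pmatrix} a&b\\ c&d\end{pmatrix}$. Crank generating function: $C(x,q)=\frac{(q;q)_\infty}{(xq;q)_\infty(x^{-1}q;q)_\infty}$. For $1\le\ell\le p-1$ write $C(\zeta_p^\ell,q)=\sum_{n\ge0}c_\ell(n)q^n$, $c_\ell(n)=0$ for $n<0$ (equivalently $c_\ell(n)=\sum_{k=0}^{p-1}M(k,p,n)\zeta_p^{k\ell}$ with $M(k,p,n)$ the number of partitions of $n$ with crank $\equiv k\pmod p$, generating-function convention at $n=1$). With $s_p=\frac{p^2-1}{24}$, for any integer $m$ define $\mathcal{K}^{(C)}_{p,m}(\zeta_p^{\ell},z)=q^{m/p}\prod_{n\ge1}(1-q^{pn})\sum_{n\in\mathbb{Z}}c_\ell(pn+m-s_p)\,q^n$; this depends only on $m$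 modulo $p$. *)

(* Defs.v *)
From HB Require Import structures.
From mathcomp Require Import all_boot all_order all_algebra.
From mathcomp Require Import all_classical all_reals all_analysis.
From mathcomp Require Import complex.
Set Implicit Arguments. Unset Strict Implicit. Unset Printing Implicit Defensive.
Import Order.TTheory GRing.Theory Num.Theory numFieldNormedType.Exports.
Local Open Scope ring_scope.
Local Open Scope complex_scope.

Section Defs.
Variable R : realType.
Local Notation C := R[i].

Definition limC (u : nat -> C) : C :=
  (limn ((fun n => complex.Re (u n)) : nat -> R)) +i* (limn ((fun n => complex.Im (u n)) : nat -> R)).

(* e^{2 pi i r z}, i.e. q^r with q = e^{2 pi i z} *)
Definition qpow (r : R) (z : C) : C :=
  (expR (- (2 * pi * r * complex.Im z)))%:C *
  ((cos (2 * pi * r * complex.Re z)) +i* (sin (2 * pi * r * complex.Re z))).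

Definition zeta (p : nat) : C :=
  (cos (2 * pi / p%:R)) +i* (sin (2 * pi / p%:R)).

(* truncation of C(x,q) = (q;q)_oo / ((xq;q)_oo (x^{-1}q;q)_oo) which is exact
   up to the coefficient of q^N *)
Definition crank_trunc (x : C) (N : nat) : {poly C} :=
  \prod_(1 <= k < N.+1)
     ((1 - 'X^k) * (\sum_(j < N.+1) (x ^+ j)%:P * 'X^(k * j))
                 * (\sum_(j < N.+1) (x^-1 ^+ j)%:P * 'X^(k * j))).

Definition crank_coef (x : C) (n : int) : C :=
  match n with
  | Posz n => (crank_trunc x n)`_n
  | Negz _ => 0
  end.

Definition s_p (p : nat) : nat := (p ^ 2 - 1) %/ 24.

Definition eta_prod (p : nat) (z : C) : C :=
  limC (fun N => \prod_(1 <= n < N.+1) (1 - qpow (p * n)%:R z)).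

Definition K_series (p : nat) (x : C) (m : int) (z : C) : C :=
  limC (fun N => \sum_(i < (2 * N).+1)
          let n : int := (i%:Z - N%:Z)%R in
          crank_coef x (p%:Z * n + m - (s_p p)%:Z)%R * qpow n%:~R z).

Definition K_C (p : nat) (x : C) (m : int) (z : C) : C :=
  qpow (m%:~R / p%:R) z * eta_prod p z * K_series p x m z.

Definition slash1 (F : C -> C) (a b c d : int) (z : C) : C :=
  (c%:~R * z + d%:~R)^-1 * F ((a%:~R * z + b%:~R) / (c%:~R * z + d%:~R)).

End Defs.

(* Main.v *)
(* Write [q = e^{2 pi i w}], [zeta = e^{2 pi i / p}], [s = (p^2 - 1) / 24] and
   [H_l(w) = q^s (q^{p^2}; q^{p^2})_oo C(zeta^l, q)].  Filtering exponents modulo p,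
   [K_{p,m}(zeta^l, z) = p^{-1} sum_{j mod p} zeta^{-mj} H_l((z + j) / p)], and A permutes
   the points [(z + j) / p] up to matrices [B = (al, be; p^2, de)], where de may be chosen
   odd.  So it suffices to know [H_1] at [B w].

   Let [phi(u; w)] be [theta_1(u; w) / eta(w)^3], given by its product.  Then [H_l] is a
   constant times [eta(p^2 w) / eta(w) / phi(l / p; w)].  Moreover [eta(w)^24] is a power of
   the product of the values of phi at the 2-torsion points, and [eta(p w) / eta(w)^p] is the
   product of the values at the p-torsion points [j / p], [j <= (p - 1) / 2]; so all of [H_l]
   is expressed by values of phi at torsion points, and everything follows from the
   transformation of phi under SL_2(Z), that is under [w |-> -1 / w].

   By the sine product, phi is [u] times the product of [1 - u^2 / omega^2] over half of the
   lattice, in an iterated order; [w |-> -1 / w] swaps the two orders.  The quotient G of the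
   two products is multiplicative in [u^2]: for [u^2 + v^2 + r^2 = 0] the combined product of
   three factors converges absolutely.  After removing the factor [e^{pi i u^2 / w}], G is
   also periodic in u, and these two properties force it to be 1. *)

(* The obstacle is the multiplier of eta, a 24th root of unity given by Dedekind sums; it is never
   computed. Since p^2 - 1 = 24 s, the quotient eta(p^2 w) / eta(w) is eta(p^2 w) / eta(p w)^p,
   times the p-th power of eta(p w) / eta(w)^p, times (eta(w)^24)^s. The last factor needs only the
   weight 12 law of the discriminant. In the other two, an unknown sign occurs to the even power p +
   1. What remains are multipliers of phi at p-torsion points. Because the lower left entry of B is
   p^2, such a point j / p goes to a lattice translate of j de / p, so its multiplier is an explicit
   root of unity; these are trivial, singly or in product, when de is odd. The parity can be
   arranged because de = d + p e with e fixed only modulo the odd p; the price is a factor (-1)^e in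
   sin(pi de / p), and this is the sign (-1)^{d+1} of the theorem. *)
Require Import Defs.
From HB Require Import structures.
From mathcomp Require Import all_boot all_order all_algebra.
From mathcomp Require Import all_classical all_reals all_analysis.
From mathcomp Require Import complex ring lra zify.
Set Implicit Arguments. Unset Strict Implicit. Unset Printing Implicit Defensive.
Import Order.TTheory GRing.Theory Num.Theory numFieldNormedType.Exports.
Local Open Scope ring_scope.
Local Open Scope complex_scope.

(** * Limits, series and infinite products of complex numbers *)

Section ComplexLimits.
Variable R : realType.
Local Notation C := R[i].
Implicit Types (u v : nat -> C) (x y z : C).

(** The norm of [R[i]] takes values in [R[i]]; estimates and real limits need a modulus with values
    in [R]. *)
Definition nrm (z : C) : R := ComplexField.Normc.normc z.

Lemma nrmE z : (nrm z)%:C = `|z|.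
Proof. by case: z => a b; rewrite normc_def. Qed.

Lemma nrm_ge0 z : 0 <= nrm z. 
Proof. by case: z => a b; rewrite /nrm /= sqrtr_ge0. Qed.

Lemma nrmM x y : nrm (x * y) = nrm x * nrm y.
Proof. exact: ComplexField.Normc.normcM. Qed.

Lemma nrmD x y : nrm (x + y) <= nrm x + nrm y.
Proof. exact: le_normcD. Qed.

Lemma nrmN x : nrm (- x) = nrm x.
Proof. exact: normcN. Qed.

Lemma nrm0 : nrm 0 = 0.
Proof. exact: ComplexField.Normc.normc0. Qed.

Lemma nrm1 : nrm 1 = 1.
Proof. exact: ComplexField.Normc.normc1. Qed.

Lemma nrmB x y : nrm (x - y) <= nrm x + nrm y.
Proof. by rewrite -(nrmN y) nrmD. Qed.

Lemma nrmC x y : nrm (x - y) = nrm (y - x).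
Proof. by rewrite -nrmN opprB. Qed.

Lemma nrmV x : nrm x^-1 = (nrm x)^-1.
Proof. exact: ComplexField.Normc.normcV. Qed.

Lemma nrmX x n : nrm (x ^+ n) = nrm x ^+ n.
Proof. by elim: n => [|n IH]; rewrite ?expr0 ?nrm1// !exprS nrmM IH. Qed.

Lemma nrm_eq0 x : (nrm x == 0) = (x == 0).
Proof.
apply/eqP/eqP => [/ComplexField.Normc.eq0_normc//|->]; exact: nrm0.
Qed.

Lemma nrm_real (a : R) : nrm a%:C = `|a|.
Proof. by rewrite /nrm /= expr0n /= addr0 sqrtr_sqr. Qed.

Lemma nrm_nat n : nrm (n%:R : C) = n%:R.
Proof. by apply: complexI; rewrite nrmE normr_nat rmorph_nat. Qed.

Lemma nrm_sum I r (P : pred I) (F : I -> C) :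
  nrm (\sum_(i <- r | P i) F i) <= \sum_(i <- r | P i) nrm (F i).
Proof.
elim/big_ind2 : _ => [|x1 x2 y1 y2 h1 h2|//]; first by rewrite nrm0.
by apply: le_trans (nrmD _ _) _; rewrite lerD.
Qed.

Lemma nrm_prod I r (P : pred I) (F : I -> C) :
  nrm (\prod_(i <- r | P i) F i) = \prod_(i <- r | P i) nrm (F i).
Proof. exact: (big_morph nrm nrmM nrm1). Qed.

Lemma Re_le_nrm z : `|complex.Re z| <= nrm z.
Proof. by rewrite -lecR nrmE normc_ge_Re. Qed.

Lemma Im_le_nrm z : `|complex.Im z| <= nrm z.
Proof.
have := Re_le_nrm (z * 'i); rewrite ReiNIm normrN nrmM.
suff -> : nrm 'i = 1 by rewrite mulr1.
by rewrite /nrm /= expr0n /= add0r expr1n sqrtr1.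
Qed.

Lemma nrm_le_ReIm z : nrm z <= `|complex.Re z| + `|complex.Im z|.
Proof.
rewrite {1}[z]complexE; apply: le_trans (nrmD _ _) _.
rewrite nrmM !nrm_real lerD2l.
by rewrite /nrm /= expr0n /= add0r expr1n sqrtr1 mul1r.
Qed.

Lemma cReD x y : complex.Re (x + y) = complex.Re x + complex.Re y.
Proof. by case: x; case: y. Qed.
Lemma cImD x y : complex.Im (x + y) = complex.Im x + complex.Im y.
Proof. by case: x; case: y. Qed.
Lemma cReN x : complex.Re (- x) = - complex.Re x.
Proof. by case: x. Qed.
Lemma cImN x : complex.Im (- x) = - complex.Im x.
Proof. by case: x. Qed.
Lemma cReM x y : complex.Re (x * y) =
  complex.Re x * complex.Re y - complex.Im x * complex.Im y.
Proof. by case: x; case: y. Qed.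
Lemma cImM x y : complex.Im (x * y) =
  complex.Re x * complex.Im y + complex.Im x * complex.Re y.
Proof. by case: x; case: y. Qed.

Lemma Re_sum n (F : nat -> C) :
  complex.Re (\sum_(i < n) F i) = \sum_(i < n) complex.Re (F i).
Proof. by elim: n => [|n IH]; rewrite ?big_ord0// !big_ord_recr /= cReD IH. Qed.
Lemma Im_sum n (F : nat -> C) :
  complex.Im (\sum_(i < n) F i) = \sum_(i < n) complex.Im (F i).
Proof. by elim: n => [|n IH]; rewrite ?big_ord0// !big_ord_recr /= cImD IH. Qed.

(** Componentwise because [limC] is. An equation on [limC], which has a value even for divergent
    sequences, would not record that the limit exists. *)
Definition ccvg u (l : C) : Prop :=
  ((fun n => complex.Re (u n)) @ \oo --> complex.Re l)%classic /\
  ((fun n => complex.Im (u n)) @ \oo --> complex.Im l)%classic.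

Lemma limC_ccvg u l : ccvg u l -> limC u = l.
Proof.
case: l => a b [/= ha hb]; rewrite /limC.
by congr (_ +i* _); apply/cvg_lim.
Qed.

Lemma ccvg_unique u l l' : ccvg u l -> ccvg u l' -> l = l'.
Proof. by move=> /limC_ccvg <- /limC_ccvg. Qed.

Lemma ccvg_cst x : ccvg (fun=> x) x.
Proof. by split; apply: cvg_cst. Qed.

Lemma ccvgD u v x y : ccvg u x -> ccvg v y -> ccvg (fun n => u n + v n) (x + y).
Proof.
move=> [ux ux'] [vy vy']; split.
  rewrite cReD; under eq_fun do rewrite cReD; exact: cvgD.
rewrite cImD; under eq_fun do rewrite cImD; exact: cvgD.
Qed.

Lemma ccvgN u x : ccvg u x -> ccvg (fun n => - u n) (- x).
Proof.
move=> [ux ux']; split.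
  rewrite cReN; under eq_fun do rewrite cReN; exact: cvgN.
rewrite cImN; under eq_fun do rewrite cImN; exact: cvgN.
Qed.

Lemma ccvgB u v x y : ccvg u x -> ccvg v y -> ccvg (fun n => u n - v n) (x - y).
Proof. by move=> ux vy; apply: ccvgD => //; apply: ccvgN. Qed.

Lemma ccvgM u v x y : ccvg u x -> ccvg v y -> ccvg (fun n => u n * v n) (x * y).
Proof.
move=> [ux ux'] [vy vy']; split.
  rewrite cReM; under eq_fun do rewrite cReM.
  by apply: cvgB; apply: cvgM.
rewrite cImM; under eq_fun do rewrite cImM.
by apply: cvgD; apply: cvgM.
Qed.

Lemma ccvg_ext u v l : (forall n, u n = v n) -> ccvg u l -> ccvg v l.
Proof. by move=> /funext ->. Qed.

Lemma ccvgX u x k : ccvg u x -> ccvg (fun n => u n ^+ k) (x ^+ k).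
Proof.
move=> ux; elim: k => [|k IH]; first exact: ccvg_cst.
by rewrite exprS; apply: ccvg_ext (ccvgM ux IH) => n; rewrite exprS.
Qed.

Lemma ccvg_nrm u l :
  ccvg u l <-> ((fun n => nrm (u n - l)) @ \oo --> (0 : R))%classic.
Proof.
split=> [ul|].
  have [h1 h2] := ccvgB ul (ccvg_cst l).
  have h : ((fun n => `|complex.Re (u n - l)| + `|complex.Im (u n - l)|) @ \oo
     --> (0 : R))%classic.
    rewrite [X in (_ --> X)%classic](_ : 0 = `|complex.Re (l - l)| + `|complex.Im (l - l)|); last first.
      by rewrite subrr /= !normr0 addr0.
    by apply: cvgD; apply: cvg_norm.
  apply: (squeeze_cvgr _ (cvg_cst 0) h).
  by apply: nearW => n; rewrite nrm_ge0 nrm_le_ReIm.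
move=> h; have hN : ((fun n => - nrm (u n - l)) @ \oo --> (0 : R))%classic.
  by rewrite -oppr0; apply: cvgN.
have H f (L : R) : (forall n, `|f n - L| <= nrm (u n - l)) -> (f @ \oo --> L)%classic.
  move=> fL; apply/subr_cvg0.
  apply: (squeeze_cvgr _ hN h).
  by apply: nearW => n; rewrite -ler_norml fL.
split; apply: H => n.
  by rewrite -cReN -cReD Re_le_nrm.
by rewrite -cImN -cImD Im_le_nrm.
Qed.

Lemma ccvgP u l :
  ccvg u l <-> forall e : R, 0 < e -> exists N, forall n, (N <= n)%N -> nrm (u n - l) < e.
Proof.
rewrite ccvg_nrm; split.
  move=> /cvgr0Pnorm_lt h e /h [N _ hN]; exists N => n Nn.
  by have := hN n Nn => /=; rewrite ger0_norm ?nrm_ge0.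
move=> h; apply/cvgr0Pnorm_lt => e /h [N hN]; exists N => // n /= Nn.
by rewrite ger0_norm ?nrm_ge0// hN.
Qed.

Lemma ccvg_ev u v l N : (forall n, (N <= n)%N -> u n = v n) -> ccvg u l -> ccvg v l.
Proof.
move=> uv /ccvgP ul; apply/ccvgP => e /ul [M hM]; exists (maxn M N) => n.
by rewrite geq_max => /andP[Mn Nn]; rewrite -uv// hM.
Qed.

Lemma ccvg_sub u l (f : nat -> nat) :
  (forall n, (n <= f n)%N) -> ccvg u l -> ccvg (fun n => u (f n)) l.
Proof.
move=> hf /ccvgP ul; apply/ccvgP => e /ul [M hM]; exists M => n Mn.
by apply: hM; apply: leq_trans (hf n).
Qed.

Lemma ccvg_bound u l : ccvg u l -> exists2 B, 0 < B & forall n, nrm (u n) <= B.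
Proof.
move=> /ccvgP /(_ 1 ltr01) [N hN].
exists (nrm l + 1 + \sum_(i < N) nrm (u i)) => [|n].
  rewrite ltr_wpDr ?sumr_ge0 ?ltr_wpDl ?nrm_ge0// => i _; exact: nrm_ge0.
have [Nn|nN] := leqP N n.
  rewrite -[u n](subrK l) addrC -addrA; apply: le_trans (nrmD _ _) _; rewrite lerD2l.
  by rewrite ler_wpDr ?sumr_ge0 ?ltW ?hN// => i _; exact: nrm_ge0.
rewrite ler_wpDl ?addr_ge0 ?nrm_ge0//.
rewrite (bigD1 (Ordinal nN)) //= lerDl sumr_ge0// => i _; exact: nrm_ge0.
Qed.

Lemma ccvg_nrm_le u l B : (forall n, nrm (u n) <= B) -> ccvg u l -> nrm l <= B.
Proof.
move=> uB /ccvgP ul; apply/ler_addgt0Pr => e /ul [N /(_ N (leqnn N))].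
rewrite nrmC => /ltW h; rewrite -[l](subrK (u N)) addrC.
by apply: le_trans (nrmD _ _) _; rewrite lerD.
Qed.

Lemma ccvgV u l : l != 0 -> ccvg u l -> ccvg (fun n => (u n)^-1) l^-1.
Proof.
move=> l0 ul.
have h (z : C) : z^-1 = (complex.Re z / (complex.Re z ^+ 2 + complex.Im z ^+ 2)) +i*
    (- (complex.Im z) / (complex.Re z ^+ 2 + complex.Im z ^+ 2)).
  by case: z => a b /=; rewrite mulNr.
case: ul => u1 u2.
have nz : complex.Re l ^+ 2 + complex.Im l ^+ 2 != 0.
  move: l0; rewrite -nrm_eq0; case: (l) => a b; rewrite /nrm /= sqrtr_eq0.
  by rewrite -ltNge lt_def => /andP[].
have hd : ((fun n => complex.Re (u n) ^+ 2 + complex.Im (u n) ^+ 2)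
   @ \oo --> complex.Re l ^+ 2 + complex.Im l ^+ 2)%classic.
  apply: cvgD; [rewrite expr2|rewrite expr2]; under eq_fun do rewrite expr2; exact: cvgM.
split.
  rewrite h; under eq_fun do rewrite h.
  by apply: cvgM => //; apply: cvgV.
rewrite h; under eq_fun do rewrite h.
by apply: cvgM; [apply: cvgN|apply: cvgV].
Qed.

Lemma ccvg_prod n (F : nat -> nat -> C) (L : nat -> C) :
  (forall i, ccvg (F i) (L i)) ->
  ccvg (fun k => \prod_(i < n) F i k) (\prod_(i < n) L i).
Proof.
move=> h; elim: n => [|n IH].
  rewrite big_ord0; apply: ccvg_ext (ccvg_cst 1) => k; by rewrite big_ord0.
rewrite big_ord_recr /=; apply: ccvg_ext (ccvgM IH (h n)) => k.
by rewrite big_ord_recr.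
Qed.

Lemma ccvg_sum n (F : nat -> nat -> C) (L : nat -> C) :
  (forall i, ccvg (F i) (L i)) ->
  ccvg (fun k => \sum_(i < n) F i k) (\sum_(i < n) L i).
Proof.
move=> h; elim: n => [|n IH].
  rewrite big_ord0; apply: ccvg_ext (ccvg_cst 0) => k; by rewrite big_ord0.
rewrite big_ord_recr /=; apply: ccvg_ext (ccvgD IH (h n)) => k.
by rewrite big_ord_recr.
Qed.

Lemma bounded_sum_tail (t : nat -> R) (S : R) : (forall n, 0 <= t n) ->
  (forall n, \sum_(i < n) t i <= S) ->
  forall e, 0 < e -> exists N, forall n m, (N <= n)%N -> (n <= m)%N ->
    \sum_(n <= i < m) t i <= e.
Proof.
move=> t0 tS e e0; set s := fun n => \sum_(i < n) t i.
have s_nd : {homo s : n m / (n <= m)%N >-> n <= m}.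
  apply/nondecreasing_seqP => n; by rewrite /s big_ord_recr /= lerDl.
have : cvgn s.
  apply: nondecreasing_is_cvgn => //.
  by exists S => _ [n _ <-]; apply: tS.
move=> sl; have le_lim n : s n <= limn s by apply: nondecreasing_cvgn_le.
have [N _ hN] := proj1 (cvgrPdist_lt _ _) sl e e0; exists N => n m Nn nm.
have -> : \sum_(n <= i < m) t i = s m - s n.
  rewrite /s -!(big_mkord xpredT) (big_cat_nat (leq0n n) nm) /=.
  by rewrite addrAC subrr add0r.
have := hN n Nn => /=; rewrite ger0_norm ?subr_ge0// => h.
by apply: le_trans (ltW h); rewrite lerD2r.
Qed.

Lemma abs_series_ccvg (F : nat -> C) (S : R) :
  (forall n, \sum_(i < n) nrm (F i) <= S) ->
  exists l, ccvg (fun n => \sum_(i < n) F i) l.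
Proof.
move=> hS.
have key (f : nat -> R) : (forall n, `|f n| <= nrm (F n)) ->
    cvgn (fun n => \sum_(i < n) f i).
  move=> hf; rewrite [X in cvgn X](_ : _ = series f); last first.
    by apply/funext => n; rewrite /series /= big_mkord.
  apply: normed_cvg.
  apply: nondecreasing_is_cvgn.
    apply: nondecreasing_series => i _ _; exact: normr_ge0.
  exists S => _ [n _ <-]; rewrite /normed_series_of seriesEord /=.
  apply: le_trans (hS n); exact: ler_sum.
have h1 := key (fun n => complex.Re (F n)) (fun n => Re_le_nrm _).
have h2 := key (fun n => complex.Im (F n)) (fun n => Im_le_nrm _).
exists (limn (fun n => \sum_(i < n) complex.Re (F i)) +i*
        limn (fun n => \sum_(i < n) complex.Im (F i))); split => /=.
  by under eq_fun do rewrite Re_sum.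
by under eq_fun do rewrite Im_sum.
Qed.

Lemma nrm_prod1D_le (F : nat -> C) (t : nat -> R) (S : R) :
  (forall n, nrm (F n) <= t n) -> (forall n, \sum_(i < n) t i <= S) ->
  forall n, nrm (\prod_(i < n) (1 + F i)) <= expR S.
Proof.
move=> Ft tS n; apply: (@le_trans _ _ (expR (\sum_(i < n) t i))); last by rewrite ler_expR.
rewrite nrm_prod expR_sum; apply: ler_prod => i _; rewrite nrm_ge0 /=.
apply: le_trans (nrmD _ _) _; rewrite nrm1.
by apply: le_trans (expR_ge1Dx _); rewrite lerD2l.
Qed.

(** Telescoping: one more factor changes the product by [F m] times a product already bounded by
    [expR S]. Here and below, summability is expressed by a bound [S] on all partial sums of a
    majorant [t]. *)
Lemma nrm_prod_tail_le (F : nat -> C) (t : nat -> R) (S : R) :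
  (forall n, nrm (F n) <= t n) -> (forall n, \sum_(i < n) t i <= S) ->
  forall n m, (n <= m)%N ->
  nrm (\prod_(i < m) (1 + F i) - \prod_(i < n) (1 + F i)) <=
    expR S * \sum_(n <= i < m) t i.
Proof.
move=> Ft tS n m nm; elim: m nm => [|m IH].
  by rewrite leqn0 => /eqP ->; rewrite subrr nrm0 big_geq// mulr0.
rewrite leq_eqVlt ltnS => /orP[/eqP ->|nm].
  by rewrite subrr nrm0 big_geq// mulr0.
rewrite big_nat_recr //= mulrDr big_ord_recr /= mulrDr mulr1 addrAC.
apply: le_trans (nrmD _ _) _; apply: lerD; first exact: IH.
rewrite nrmM ler_pM ?nrm_ge0//; exact: nrm_prod1D_le.
Qed.

Lemma prod1D_ccvg (F : nat -> C) (t : nat -> R) (S : R) :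
  (forall n, nrm (F n) <= t n) -> (forall n, \sum_(i < n) t i <= S) ->
  exists l, ccvg (fun n => \prod_(i < n) (1 + F i)) l.
Proof.
move=> Ft tS; set P := fun n => \prod_(i < n) (1 + F i).
have [|l hl] := @abs_series_ccvg (fun n => P n.+1 - P n) (expR S * S).
  move=> n; apply: le_trans (_ : \sum_(i < n) expR S * t i <= _); last first.
    by rewrite -mulr_sumr ler_wpM2l ?expR_ge0.
  apply: ler_sum => i _; rewrite /P big_ord_recr /= mulrDr mulr1 addrAC subrr add0r.
  rewrite nrmM ler_pM ?nrm_ge0//; exact: (nrm_prod1D_le Ft tS).
exists (l + 1); apply: ccvg_ext (ccvgD hl (ccvg_cst 1)) => n.
rewrite -(big_mkord xpredT (fun i => P i.+1 - P i)) telescope_sumr// {2}/P big_ord0.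
by rewrite subrK.
Qed.

(** Tannery's theorem for products: the majorant makes the tails beyond [J] small uniformly in [M],
    and the first [J] factors converge one by one. It serves for the sine product, for the exchange
    of rows and columns, and for the geometric sums of the crank function. *)
Lemma prod_dominated_ccvg (a : nat -> nat -> C) (b : nat -> C) (t : nat -> R) (S : R)
    (P : nat -> C) (Q : C) :
  (forall M n, nrm (a M n) <= t n) -> (forall n, \sum_(i < n) t i <= S) ->
  (forall n, ccvg (fun M => a M n) (b n)) ->
  (forall M, ccvg (fun J => \prod_(n < J) (1 + a M n)) (P M)) ->
  ccvg (fun J => \prod_(n < J) (1 + b n)) Q ->
  ccvg P Q.
Proof.
move=> at_ tS ab aP bQ.
have t0 n : 0 <= t n by apply: le_trans (nrm_ge0 _) (at_ 0%N n).
have bt n : nrm (b n) <= t n by apply: ccvg_nrm_le (ab n) => M; apply: at_.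
apply/ccvgP => e e0.
have e3 : 0 < e / 4 by rewrite divr_gt0.
have eS : 0 < e / 4 / expR S by rewrite divr_gt0 ?expR_gt0.
have [J hJ] := bounded_sum_tail t0 tS eS.
have tail (F : nat -> C) l : (forall n, nrm (F n) <= t n) ->
    ccvg (fun K => \prod_(n < K) (1 + F n)) l ->
    nrm (l - \prod_(n < J) (1 + F n)) <= e / 4.
  move=> Ft hl; apply/ler_addgt0Pr => d d0.
  have [N hN] := proj1 (ccvgP _ _) hl d d0.
  set K := maxn N J.
  rewrite -[l](subrK (\prod_(n < K) (1 + F n))) -addrA addrC.
  apply: le_trans (nrmD _ _) _; apply: lerD; last first.
    by rewrite nrmC ltW// hN// leq_maxl.
  apply: le_trans (nrm_prod_tail_le Ft tS (leq_maxr N J)) _.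
  rewrite -ler_pdivlMl ?expR_gt0// mulrC; apply: hJ => //; exact: leq_maxr.
have fin : ccvg (fun M => \prod_(n < J) (1 + a M n)) (\prod_(n < J) (1 + b n)).
  apply: (@ccvg_prod J (fun n M => 1 + a M n) (fun n => 1 + b n)) => i.
  by apply: ccvgD => //; apply: ccvg_cst.
have [N hN] := proj1 (ccvgP _ _) fin _ e3.
exists N => M NM.
have h1 := tail _ _ (at_ M) (aP M).
have h2 := tail _ _ bt bQ.
have h3 := hN M NM.
set x := \prod_(n < J) (1 + a M n) in h1 h3; set y := \prod_(n < J) (1 + b n) in h2 h3.
have -> : P M - Q = (P M - x) + (x - y) + (y - Q) by ring.
rewrite nrmC in h2.
have := nrmD (P M - x + (x - y)) (y - Q); have := nrmD (P M - x) (x - y).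
lra.
Qed.

Lemma sum_inv_sqr_le n : \sum_(i < n) (i.+1%:R ^- 2 : R) <= 2.
Proof.
(* The comparison of [1 / (x + 1)^2] with [1 / x - 1 / (x + 1)] proves this sharper bound, which is
   fit for induction. *)
suff h : \sum_(i < n) (i.+1%:R ^- 2 : R) <= 2 - n.+1%:R^-1.
  by apply: le_trans h _; rewrite gerBl invr_ge0.
case: n => [|n]; first by rewrite big_ord0 invr1 subr_ge0 ler1n.
rewrite big_ord_recl /= expr1n invr1.
suff h : \sum_(i < n) (i.+2%:R ^- 2 : R) <= 1 - n.+1%:R^-1.
  have h' : (n.+2%:R : R)^-1 <= n.+1%:R^-1 by rewrite lef_pV2 ?posrE ?ler_nat.
  apply: le_trans (_ : 1 + (1 - n.+1%:R^-1) <= _); first by rewrite lerD2l.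
  by rewrite addrA lerD2l lerN2.
elim: n => [|n IH]; first by rewrite big_ord0 invr1 subrr.
rewrite big_ord_recr /=; apply: le_trans (lerD IH (lexx _)) _.
have h : 0 < (n.+1%:R : R) by [].
have -> : (n.+2%:R : R) = n.+1%:R + 1 by rewrite -[n.+2]addn1 natrD.
set x : R := n.+1%:R in h *.
rewrite -subr_ge0.
have -> : 1 - (x + 1)^-1 - (1 - x^-1 + (x + 1) ^- 2) = (x * (x + 1) ^+ 2)^-1.
  by field; rewrite !lt0r_neq0// ltr_wpDl// ltW.
by rewrite invr_ge0 mulr_ge0 ?sqr_ge0 ?ltW.
Qed.
End ComplexLimits.

(** * The exponential e^{2 pi i z} *)

Section Exponential.
Variable R : realType.
Local Notation C := R[i].
Implicit Types (u v w x y z : C).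

(* e^{2 pi i z} *)
Definition ce (z : C) : C :=
  (expR (- (2 * pi * complex.Im z)))%:C *
  ((cos (2 * pi * complex.Re z)) +i* (sin (2 * pi * complex.Re z))).

Lemma Re_realM (r : R) z : complex.Re (r%:C * z) = r * complex.Re z.
Proof. by rewrite cReM /= mul0r subr0. Qed.

Lemma Im_realM (r : R) z : complex.Im (r%:C * z) = r * complex.Im z.
Proof. by rewrite cImM /= mul0r addr0. Qed.

Lemma qpowE (r : R) z : qpow r z = ce (r%:C * z).
Proof. by rewrite /qpow /ce Re_realM Im_realM !mulrA. Qed.

Lemma ceD z w : ce (z + w) = ce z * ce w.
Proof.
rewrite /ce cReD cImD !mulrDr cosD sinD opprD expRD rmorphM /=.
rewrite mulrACA; congr (_ * _).
by apply/eqP; rewrite eq_complex /= eqxx /= addrC.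
Qed.

Lemma ce0 : ce 0 = 1.
Proof. by rewrite /ce /= !mulr0 oppr0 expR0 cos0 sin0 mul1r. Qed.

Lemma ce_mulN z : ce z * ce (- z) = 1.
Proof. by rewrite -ceD subrr ce0. Qed.

Lemma ce_neq0 z : ce z != 0.
Proof.
apply: contra_eq_neq (ce_mulN z) => ->; by rewrite mul0r eq_sym oner_eq0.
Qed.

Lemma ceN z : ce (- z) = (ce z)^-1.
Proof. by apply: (mulfI (ce_neq0 z)); rewrite ce_mulN divff// ce_neq0. Qed.

Lemma ceB z w : ce (z - w) = ce z / ce w.
Proof. by rewrite ceD ceN. Qed.

Lemma ceMn n z : ce (n%:R * z) = ce z ^+ n.
Proof.
elim: n => [|n IH]; first by rewrite mul0r ce0 expr0.
by rewrite exprS -IH -ceD -natr1; congr ce; ring.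
Qed.

Lemma ceMz (n : int) z : ce (n%:~R * z) = ce z ^ n.
Proof.
case: n => n; first by rewrite -exprnP -ceMn.
by rewrite NegzE mulrNz mulNr ceN -exprnN -ceMn.
Qed.

Lemma nrm_ce z : nrm (ce z) = expR (- (2 * pi * complex.Im z)).
Proof.
rewrite /ce nrmM nrm_real ger0_norm ?expR_ge0// /nrm /= cos2Dsin2 sqrtr1.
by rewrite mulr1.
Qed.

Lemma nrm_ce_real (a : R) : nrm (ce a%:C) = 1.
Proof. by rewrite nrm_ce /= mulr0 oppr0 expR0. Qed.

Lemma nrm_ce_lt1 z : 0 < complex.Im z -> nrm (ce z) < 1.
Proof.
by move=> z0; rewrite nrm_ce -expR0 ltr_expR oppr_lt0 mulr_gt0 ?mulr_gt0 ?pi_gt0.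
Qed.

Lemma ce_realE (a : R) : ce a%:C = cos (2 * pi * a) +i* sin (2 * pi * a).
Proof. by rewrite /ce /= mulr0 oppr0 expR0 mul1r. Qed.

Lemma ce1 : ce 1 = 1.
Proof.
by rewrite (ce_realE 1) mulr1 mulrC mulr_natr cos2pi sin2pi.
Qed.

Lemma ce_int (n : int) : ce n%:~R = 1.
Proof. by rewrite -[_%:~R]mulr1 ceMz ce1 exp1rz. Qed.

Lemma ceDint z (n : int) : ce (z + n%:~R) = ce z.
Proof. by rewrite ceD ce_int mulr1. Qed.

Lemma real_complex_half : (2^-1 : R)%:C = 2^-1 :> C.
Proof. by rewrite fmorphV rmorph_nat. Qed.

Lemma ce_half : ce 2^-1 = -1.
Proof.
rewrite -real_complex_half ce_realE mulrAC divff ?pnatr_eq0// mul1r cospi sinpi.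
by apply/eqP; rewrite eq_complex /= oppr0 !eqxx.
Qed.

Lemma ce_eq1 z : ce z = 1 -> exists n : int, z = n%:~R.
Proof.
move=> h; have pi0 := pi_gt0 R.
have Imz : complex.Im z = 0.
  move/(congr1 (@nrm R)): h; rewrite nrm_ce nrm1 => h; have /expR_inj := etrans h (esym (expR0 R)).
  by move/eqP; rewrite oppr_eq0 !mulf_eq0 pnatr_eq0 (gt_eqF pi0) /= => /eqP.
have [a za] : exists a : R, z = a%:C.
  by exists (complex.Re z); rewrite [LHS]complexE Imz rmorph0 mulr0 addr0.
rewrite {Imz}za in h *.
exists (Num.floor a).
set f := a - (Num.floor a)%:~R.
(* Only the fractional part matters: [0 < f < 1] would give [sin (pi * f) > 0], against
   [cos (2 pi f) = 1 - 2 sin (pi f)^2]. *)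
have hf : ce f%:C = 1.
  rewrite /f rmorphB ceB h.
  by rewrite rmorph_int ce_int divr1.
have f01 : 0 <= f < 1.
  by rewrite /f subr_ge0 floor_le /= ltrBlDr addrC -[1]/(1%:~R) -intrD floorD1_gt.
suff f0 : f = 0 by rewrite -(rmorph_int (real_complex R)); congr (_%:C); apply/eqP; rewrite -subr_eq0 -/f f0.
apply/eqP; apply/negPn/negP => fn0.
have : sin (pi * f) > 0.
  case/andP: f01 => f0 f1; apply: sin_gt0_pi.
  have fp : 0 < f by rewrite lt_def fn0.
  by rewrite mulr_gt0//= gtr_pMr.
move: hf; rewrite ce_realE => -[hc hs].
have : cos (2 * pi * f) = 1 - 2 * sin (pi * f) ^+ 2.
  have -> : 2 * pi * f = pi * f *+ 2 by ring.
  by rewrite cos_mulr2n cos2sin2; ring.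
rewrite hc => h2 /lt0r_neq0; rewrite -sqrf_eq0 => /eqP; apply; lra.
Qed.

End Exponential.

(** * Products over roots of unity *)

Lemma prod_nat_pair (A : comPzRingType) M (F : nat -> A) :
  \prod_(1 <= k < M.*2.+1) F k = \prod_(k < M) (F k.+1 * F (M.*2 - k)%N).
Proof.
rewrite big_add1 /= big_mkord -addnn big_split_ord big_split /=; congr (_ * _).
rewrite [LHS](reindex_inj rev_ord_inj) /=; apply: eq_bigr => i _.
by congr F; have := ltn_ord i; lia.
Qed.

Section Unity.
Variable A : fieldType.
Implicit Types y z : A.

(** Evaluate the factorisation of [X^n - 1] at [y^-1] and clear denominators. *)
Lemma prod_unity_1sub n z y : n.-primitive_root z ->
  \prod_(0 <= k < n) (1 - z ^+ k * y) = 1 - y ^+ n.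
Proof.
move=> zn; have n0 := prim_order_gt0 zn.
have [->|y0] := eqVneq y 0.
  by under eq_bigr do rewrite mulr0 subr0; rewrite big1_eq expr0n gtn_eqF// subr0.
have /(congr1 (fun p => p.[y^-1])) := factor_Xn_sub_1 zn.
rewrite horner_prod !hornerE => h.
rewrite (eq_bigr (fun k => y * ('X - (z ^+ k)%:P).[y^-1])) => [|k _].
  rewrite big_split /= h prodr_const_nat subn0 mulrBr mulr1 exprVn divff//.
  by rewrite expf_neq0.
by rewrite !hornerE mulrBr divff// mulrC.
Qed.

Lemma prim_expr_rev n z i j : n.-primitive_root z -> (i + j = n)%N ->
  z ^- i = z ^+ j.
Proof.
move=> zn ij; have z0 : z ^+ i != 0.
  rewrite expf_neq0//; apply: contra_eq_neq (prim_expr_order zn) => ->.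
  by rewrite expr0n gtn_eqF ?(prim_order_gt0 zn)// eq_sym oner_eq0.
by apply: (mulfI z0); rewrite divff// -exprD ij (prim_expr_order zn).
Qed.

(** Coupling [k] with [n - k] couples [z^k] with its inverse; the resulting half system [1..M] is
    what later turns products of exponentials into products of squared sines. *)
Lemma prod_unity_pair M z y : M.*2.+1.-primitive_root z ->
  (1 - y) * \prod_(k < M) ((1 - z ^+ k.+1 * y) * (1 - z ^- k.+1 * y)) =
  1 - y ^+ M.*2.+1.
Proof.
move=> zn; rewrite -(prod_unity_1sub y zn) big_ltn// expr0 mul1r prod_nat_pair.
congr (_ * _); apply: eq_bigr => k _; congr (_ * (1 - _ * _)).
by apply: (prim_expr_rev zn); have := ltn_ord k; lia.
Qed.

(** Cancel [X - 1] from [X^n - 1] and evaluate the quotient, the sum of the powers of [X], at 1. *)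
Lemma prod_unity_pair1 M z : M.*2.+1.-primitive_root z ->
  \prod_(k < M) ((1 - z ^+ k.+1) * (1 - z ^- k.+1)) = M.*2.+1%:R.
Proof.
move=> zn.
have h : \prod_(1 <= k < M.*2.+1) ('X - (z ^+ k)%:P) = \sum_(i < M.*2.+1) 'X^i.
  apply: (mulfI (x := 'X - 1%:P)); first by rewrite polyXsubC_eq0.
  by rewrite -subrX1 -(factor_Xn_sub_1 zn) [RHS]big_ltn// expr0.
have {h} := congr1 (fun p => p.[1]) h.
rewrite horner_prod horner_sum.
under [X in _ = X -> _]eq_bigr do rewrite hornerXn expr1n.
rewrite sumr_const card_ord => <-.
under [in RHS]eq_bigr do rewrite hornerXsubC.
rewrite prod_nat_pair; apply: eq_bigr => k _; congr (_ * (1 - _)).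
by apply: (prim_expr_rev zn); have := ltn_ord k; lia.
Qed.

End Unity.

(** * The function 2 i sin(pi z) and its odd multiplication formula *)

Section Sine.
Variable R : realType.
Local Notation C := R[i].
Implicit Types (u v w x y z : C).

(* 2 i sin (pi z) *)
Definition sn z : C := ce (z / 2) - ce (- (z / 2)).

Lemma snE z : sn z = ce (- (z / 2)) * (ce z - 1).
Proof. by rewrite /sn mulrBr mulr1 -ceD; congr (ce _ - _); field. Qed.

Lemma snE' z : sn z = ce (z / 2) * (1 - ce (- z)).
Proof. by rewrite /sn mulrBr mulr1 -ceD; congr (_ - ce _); field. Qed.

Lemma sn0 : sn 0 = 0.
Proof. by rewrite /sn mul0r oppr0 subrr. Qed.

Lemma snN z : sn (- z) = - sn z.
Proof. by rewrite /sn mulNr opprK opprB. Qed.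

Lemma sn_sqr z : sn z ^+ 2 = ce z + ce (- z) - 2.
Proof.
have h1 : ce (z / 2) * ce (z / 2) = ce z by rewrite -ceD; congr ce; field.
have h2 : ce (- (z / 2)) * ce (- (z / 2)) = ce (- z) by rewrite -ceD; congr ce; field.
rewrite -h1 -h2 /sn; by ring: (ce_mulN (z / 2)).
Qed.

Lemma sn_sqrN u : - sn u ^+ 2 = (1 - ce u) * (1 - ce (- u)).
Proof. by rewrite sn_sqr mulrBl mul1r mulrBr mulr1 ce_mulN; ring. Qed.

Lemma snD1 z : sn (z + 1) = - sn z.
Proof.
have h : ce (- (2^-1 : C)) = -1 by rewrite ceN ce_half invrN invr1.
by rewrite /sn mulrDl opprD !ceD div1r h ce_half; ring.
Qed.

Lemma snDint z (n : int) : sn (z + n%:~R) = (-1) ^ n * sn z.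
Proof.
elim/int_rec: n => [|n IH|n IH]; first by rewrite addr0 expr0z mul1r.
  by rewrite intS addrC intrD -addrA addrC [n%:~R + z]addrC snD1 IH exprSz; ring.
have h : sn (z - n.+1%:~R + 1) = - sn (z - n.+1%:~R) by rewrite snD1.
rewrite mulrNz; apply: oppr_inj; rewrite -h.
have -> : z - n.+1%:~R + 1 = z + (- (n : int))%:~R.
  by rewrite mulrNz intS intrD; ring.
rewrite IH -!exprnN exprS invfM invrN invr1; ring.
Qed.

Lemma sn_eq0 z : sn z = 0 -> exists n : int, z = n%:~R.
Proof.
move/eqP; rewrite snE mulf_eq0 (negbTE (ce_neq0 _)) /= subr_eq0 => /eqP; exact: ce_eq1.
Qed.

Lemma sn_real (a : R) : sn a%:C = (2 * sin (pi * a))%:C * 'i.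
Proof.
have -> : sn a%:C = ce (a / 2)%:C - ce (- (a / 2))%:C.
  by rewrite /sn rmorphN !rmorphM !fmorphV /= !rmorph_nat.
rewrite !ce_realE mulrN sinN cosN.
have -> : 2 * pi * (a / 2) = pi * a by field.
by apply/eqP; rewrite eq_complex /=; apply/andP; split; apply/eqP; ring.
Qed.

Lemma prim_ce n : (0 < n)%N -> n.-primitive_root (ce (n%:R^-1 : C)).
Proof.
move=> n0; apply/andP; split => //; apply/forallP => i; rewrite unity_rootE.
have nn : (n%:R : C) != 0 by rewrite pnatr_eq0 -lt0n.
rewrite -ceMn; apply/eqP; apply/eqP/eqP => [/ce_eq1 [m hm]|->]; last first.
  by rewrite divff// ce1.
have /eqP : (i.+1%:Z)%:~R = (m * n%:Z)%:~R :> C by rewrite intrM -hm divfK.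
rewrite eqr_int => /eqP {}hm.
by have := ltn_ord i; rewrite leq_eqVlt => /orP[/eqP //|lt]; case: m hm => [[|m]|m]; nia.
Qed.

(** The finite sine product. With [y = ce w], a pair of factors of [1 - y^N] is [(1 - z^k y) (1 -
    z^-k y) = y (sn w^2 - sn (k / N)^2)], and the product of the [- sn (k / N)^2] is [N]. *)
Lemma sn_mulodd M w : let N := M.*2.+1 in
  sn (N%:R * w) =
  N%:R * sn w * \prod_(k < M) (1 - sn w ^+ 2 / sn (k.+1%:R / N%:R) ^+ 2).
Proof.
move=> N; have zN : N.-primitive_root (ce (N%:R^-1 : C)) by apply: prim_ce.
set z := ce (N%:R^-1 : C) in zN.
have ez k : z ^+ k = ce (k%:R / N%:R) by rewrite /z -ceMn.
have ezV k : z ^- k = ce (- (k%:R / N%:R)) by rewrite ez ceN.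
have h1 := prod_unity_pair1 zN.
have h1' : \prod_(k < M) (- sn (k.+1%:R / N%:R) ^+ 2) = N%:R :> C.
  by apply: etrans h1; apply: eq_bigr => k _; rewrite sn_sqrN ezV ez.
have nz (k : 'I_M) : sn (k.+1%:R / N%:R : C) != 0.
  have : (N%:R : C) != 0 by rewrite pnatr_eq0.
  apply: contra_neq => s0; rewrite -[LHS]h1'.
  by rewrite (bigD1 k) //= s0 expr0n /= oppr0 mul0r.
have h2 := prod_unity_pair (ce w) zN.
have h3 : \prod_(k < M) ((1 - z ^+ k.+1 * ce w) * (1 - z ^- k.+1 * ce w)) =
    ce (M%:R * w) * \prod_(k < M) (sn w ^+ 2 - sn (k.+1%:R / N%:R) ^+ 2).
  rewrite ceMn -[in X in _ ^+ X * _](card_ord M) -prodr_const -big_split /=.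
  apply: eq_bigr => k _; rewrite !sn_sqr ezV ez.
  by ring: (ce_mulN w) (ce_mulN (k.+1%:R / N%:R : C)).
rewrite [N%:R * sn w]mulrC -mulrA -[X in sn w * (X * _)]h1' -big_split /=.
rewrite (eq_bigr (fun k : 'I_M => sn w ^+ 2 - sn (k.+1%:R / N%:R) ^+ 2)) => [|k _];
  last by field; exact: nz.
rewrite {}h3 -[ce w ^+ _]ceMn in h2.
move: h2; set Q := \prod_(k < M) _ => h2; rewrite !snE.
have -> : ce (- (N%:R * w / 2)) = ce (- (w / 2)) * ce (- (M%:R * w)).
  by rewrite -ceD; congr ce; rewrite /N -addn1 natrD -muln2 natrM; field.
have -> : ce (N%:R * w) - 1 = - ((1 - ce w) * (ce (M%:R * w) * Q)) by rewrite h2 opprB.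
by ring: (ce_mulN (M%:R * w)).
Qed.
End Sine.

(** * The infinite sine product *)

Section SineProduct.
Variable R : realType.
Local Notation C := R[i].
Implicit Types (u v w x y z : C).

Lemma derive_scale_cvg (f : R -> R) (f' a : R) : is_derive (0 : R) 1 f f' -> f 0 = 0 ->
  ((fun n => n.+1%:R * f (a / n.+1%:R)) @ \oo --> a * f')%classic.
Proof.
move=> df f0.
have [->|a0] := eqVneq a 0.
  under eq_fun do rewrite mul0r f0 mulr0.
  rewrite mul0r; exact: cvg_cst.
have [dfv dfE] := df.
have h : ((fun h => h^-1 *: (f (h *: 1 + 0) - f 0)) @ (0 : R)^' --> f')%classic.
  rewrite -dfE; exact: dfv.
have hs : ((fun n : nat => a / n.+1%:R) @ \oo --> (0 : R))%classic.
  rewrite -(mulr0 a); apply: cvgM; [exact: cvg_cst|exact: cvg_harmonic].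
apply/cvgrPdist_lt => e e0.
have e1 : 0 < e / `|a| by rewrite divr_gt0 ?normr_gt0.
move/cvgrPdist_lt: h => /(_ _ e1).
rewrite /dnbhs /within /= => h1; have [N _ hN] := hs _ h1; exists N => // n /= Nn.
have := hN n Nn => /=; rewrite f0 subr0 addr0.
have an0 : a / n.+1%:R != 0 by rewrite mulf_neq0// invr_neq0.
move=> /(_ an0); rewrite ltr_pdivlMr ?normr_gt0// -normrM.
congr (`|_| < _); rewrite mulrBl [a * f']mulrC; congr (_ - _).
rewrite /GRing.scale /= mulr1 invfM invrK.
by rewrite mulrC mulrA mulrA divff// mul1r.
Qed.

(** This is the derivative of [sn] at 0, obtained on real and imaginary parts from the derivatives
    of the real functions [expR] and [sin]. *)
Lemma sn_scale_ccvg z :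
  ccvg (fun n => n.+1%:R * sn (z / n.+1%:R)) ((2 * pi)%:C * 'i * z).
Proof.
case: z => a b.
have snE n : n.+1%:R * sn ((a +i* b) / n.+1%:R) =
   (cos (pi * a / n.+1%:R) * (n.+1%:R * (expR (- (pi * b) / n.+1%:R) - 1) -
                           n.+1%:R * (expR (pi * b / n.+1%:R) - 1))) +i*
   (n.+1%:R * sin (pi * a / n.+1%:R) * (expR (- (pi * b) / n.+1%:R) + expR (pi * b / n.+1%:R))).
  have zn : (a +i* b) / n.+1%:R = (a / n.+1%:R) +i* (b / n.+1%:R).
    have -> : (n.+1%:R : C)^-1 = (n.+1%:R^-1)%:C by rewrite fmorphV rmorph_nat.
    by apply/eqP; rewrite eq_complex /= !mulr0 subr0 add0r !eqxx.
  rewrite zn; set x := a / _; set y := b / _.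
  have z2 : (x +i* y) / 2 = (x / 2) +i* (y / 2).
    rewrite -real_complex_half.
    by apply/eqP; rewrite eq_complex /= !mulr0 subr0 add0r !eqxx.
  rewrite /sn z2 /ce /= !mulrN cosN sinN opprK.
  have -> : 2 * pi * (x / 2) = pi * x by field.
  have -> : 2 * pi * (y / 2) = pi * y by field.
  rewrite mulNr -!mulrA -/x -/y -(rmorph_nat (real_complex R)).
  by apply/eqP; rewrite eq_complex /=; apply/andP; split; apply/eqP; ring.
have hs (c : R) : ((fun n : nat => c / n.+1%:R) @ \oo --> (0 : R))%classic.
  rewrite -(mulr0 c); apply: cvgM; [exact: cvg_cst|exact: cvg_harmonic].
have hexp (c : R) : ((fun n => n.+1%:R * (expR (c / n.+1%:R) - 1)) @ \oo --> c)%classic.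
  have := @derive_scale_cvg (fun x : R => expR x - 1) 1 c; rewrite mulr1; apply; last first.
    by rewrite expR0 subrr.
  by apply: is_derive_eq; rewrite expR0 subr0.
have hsin (c : R) : ((fun n => n.+1%:R * sin (c / n.+1%:R)) @ \oo --> c)%classic.
  have := @derive_scale_cvg sin 1 c; rewrite mulr1; apply; last by rewrite sin0.
  by apply: is_derive_eq; rewrite cos0.
have hcos (c : R) : ((fun n => cos (c / n.+1%:R)) @ \oo --> (1 : R))%classic.
  suff: ((fun n => cos (c / n.+1%:R)) @ \oo --> cos (0 : R))%classic by rewrite cos0.
  apply: continuous_cvg; [exact: continuous_cos|exact: hs].
have hexp0 (c : R) : ((fun n => expR (c / n.+1%:R)) @ \oo --> (1 : R))%classic.
  suff: ((fun n => expR (c / n.+1%:R)) @ \oo --> expR (0 : R))%classic by rewrite expR0.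
  apply: continuous_cvg; [exact: continuous_expR|exact: hs].
split.
  under eq_fun do rewrite snE /=.
  rewrite (_ : complex.Re _ = 1 * (- (pi * b) - (pi * b))); last by rewrite /=; ring.
  by apply: cvgM => //; apply: cvgB.
under eq_fun do rewrite snE /=.
rewrite (_ : complex.Im _ = (pi * a) * (1 + 1)); last by rewrite /=; ring.
by apply: cvgM => //; apply: cvgD.
Qed.

(** Jordan's inequality with some positive constant: the mean value theorem on [[0, 1]], then
    monotonicity of [sin] together with [x <= pi / 2 < 2]. *)
Lemma sin_lower : exists2 c : R, 0 < c &
  forall x : R, 0 <= x <= pi / 2 -> c * x <= sin x.
Proof.
have c1 := cos1_gt0 R; have p2 := pihalf_lt2 R; have p1 := pihalf_ge1 R.
have small (x : R) : 0 <= x <= 1 -> cos 1 * x <= sin x.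
  move=> /andP[x0 x1]; have [->|xn0] := eqVneq x 0; first by rewrite mulr0 sin0.
  have xp : 0 < x by rewrite lt_def xn0.
  have [c] := MVT xp (fun (y : R) _ => is_derive_sin y) (continuous_subspaceT (@continuous_sin R)).
  rewrite in_itv /= sin0 !subr0 => /andP[c0 cx] ->.
  rewrite ler_pM2r//; apply: ltW; rewrite ltr_cos ?in_itv /=; lra.
exists (cos 1 / 2); first by rewrite divr_gt0.
move=> x /andP[x0 xp]; have [x1|x1] := leP x 1.
  apply: le_trans (small x _); last by rewrite x0.
  by rewrite ler_wpM2r// ler_pdivrMr// ler_peMr ?ler1n// ltW.
have s1 : cos 1 <= sin (1 : R) by have := small 1; rewrite ler01 lexx mulr1; apply.
apply: (@le_trans _ _ (sin 1)); last first.
  by apply: ltW; rewrite ltr_sin ?in_itv /=; lra.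
apply: le_trans s1; rewrite -mulrA ger_pMr//; lra.
Qed.

(** The entire function sin(pi z) / (pi z), given by its product so that the value 1 at 0 needs no
    removal of a singularity. *)
Definition sc z : C := limC (fun J => \prod_(k < J) (1 - z ^+ 2 / k.+1%:R ^+ 2)).

Lemma inv_sqr_bound (K : R) : 0 <= K ->
  forall n, \sum_(k < n) K / k.+1%:R ^+ 2 <= K * 2.
Proof. by move=> K0 n; rewrite -mulr_sumr ler_wpM2l// sum_inv_sqr_le. Qed.

Lemma sc_ccvg z : ccvg (fun J => \prod_(k < J) (1 - z ^+ 2 / k.+1%:R ^+ 2)) (sc z).
Proof.
have [||l hl] := @prod1D_ccvg R (fun k => - (z ^+ 2 / k.+1%:R ^+ 2))
   (fun k => nrm z ^+ 2 / k.+1%:R ^+ 2) (nrm z ^+ 2 * 2).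
- by move=> n; rewrite nrmN nrmM nrmV !nrmX nrm_nat.
- by apply: inv_sqr_bound; rewrite sqr_ge0.
by rewrite /sc (limC_ccvg hl).
Qed.

Lemma sc0 : sc 0 = 1.
Proof.
apply: ccvg_unique (sc_ccvg 0) _; apply: ccvg_ext (ccvg_cst 1) => n.
by rewrite big1// => i _; rewrite expr0n mul0r subr0.
Qed.

(** Let [N = 2 M + 1] tend to infinity in [sn_mulodd] at [z / N]. Each factor converges, and
    [sin_lower] bounds its distance from 1 by a constant over [(k + 1)^2], uniformly in [M]. *)
Lemma sine_product z : (2 * pi)%:C * 'i * z * sc z = sn z.
Proof.
pose N M := M.*2.+1.
have hN : ccvg (fun M => (N M)%:R * sn (z / (N M)%:R)) ((2 * pi)%:C * 'i * z).
  apply: (ccvg_sub (f := double)) (sn_scale_ccvg z) => n; lia.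
have [B B0 hB] := ccvg_bound hN.
have [c c0 hc] := sin_lower.
(* Padding by 0 beyond [M] turns the finite products into infinite ones with a common index set. *)
pose a M k := if (k < M)%N then - (sn (z / (N M)%:R) ^+ 2 / sn (k.+1%:R / (N M)%:R) ^+ 2) else 0.
pose P M := \prod_(k < M) (1 + a M k).
have B0' := ltW B0.
have cp : 0 <= 2 * c * pi by rewrite !mulr_ge0 ?pi_ge0// ltW.
have NP M : 0 < ((N M)%:R : R) by rewrite ltr0n.
(* Here [(k + 1) / N] is below 1/2, so the angle stays in the range of [sin_lower]. *)
have hk M k : (k < M)%N -> nrm (sn (k.+1%:R / (N M)%:R : C)) >= 2 * (c * (pi * (k.+1%:R / (N M)%:R))).
  move=> kM; have -> : (k.+1%:R / (N M)%:R : C) = (k.+1%:R / (N M)%:R : R)%:C.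
    by rewrite rmorphM fmorphV !rmorph_nat.
  rewrite sn_real nrmM nrm_real.
  have -> : nrm ('i : C) = 1 by rewrite /nrm /= expr0n add0r expr1n sqrtr1.
  rewrite mulr1 normrM ger0_norm// ler_pM2l//; apply: le_trans (ler_norm _).
  apply: hc; rewrite mulr_ge0 ?pi_ge0 ?divr_ge0//=.
  rewrite ler_pM2l ?pi_gt0// ler_pdivrMr// mulrC ler_pdivlMr// -natrM ler_nat /N; lia.
have PQ : ccvg P (sc z).
  apply: (@prod_dominated_ccvg R a (fun k => - (z ^+ 2 / k.+1%:R ^+ 2))
    (fun k => (B / (2 * c * pi)) ^+ 2 / k.+1%:R ^+ 2) ((B / (2 * c * pi)) ^+ 2 * 2)).
  - move=> M k; rewrite /a; case: ltnP => kM; last first.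
      by rewrite nrm0 divr_ge0 ?sqr_ge0.
    rewrite nrmN nrmM nrmV !nrmX -!expr_div_n lerXn2r ?nnegrE ?divr_ge0 ?nrm_ge0//.
    have h1 := hB M; rewrite nrmM nrm_nat mulrC -ler_pdivlMr// in h1.
    have h2 := hk M k kM.
    have p0 : 0 < 2 * (c * (pi * (k.+1%:R / (N M)%:R))) by rewrite !mulr_gt0 ?pi_gt0// invr_gt0.
    rewrite ler_pdivrMr; last exact: lt_le_trans h2.
    apply: le_trans h1 _.
    apply: (@le_trans _ _ (B / (2 * c * pi) / k.+1%:R * (2 * (c * (pi * (k.+1%:R / (N M)%:R)))))); last first.
      by rewrite ler_wpM2l// !divr_ge0// ?mulr_ge0 ?pi_ge0// ltW.
    have h (q x y : R) : 0 < q -> 0 < x -> 0 < y ->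
        B / y = B / (2 * c * q) / x * (2 * (c * (q * (x / y)))).
      by move=> q0 x0 y0; field; rewrite !lt0r_neq0.
    by rewrite -h ?pi_gt0.
  - by apply: inv_sqr_bound; rewrite sqr_ge0.
  - move=> k.
    have hd n : (n <= n.*2)%N by lia.
    have h2 := ccvg_sub hd (sn_scale_ccvg k.+1%:R).
    have i0 : ((2 * pi)%:C * 'i : C) != 0.
      rewrite -nrm_eq0 nrmM nrm_real /nrm /= expr0n add0r expr1n sqrtr1 mulr1 normr_eq0.
      by rewrite mulf_neq0 ?lt0r_neq0 ?pi_gt0.
    have k0 : (k.+1%:R : C) != 0 by rewrite pnatr_eq0.
    have h (i x y : C) : i != 0 -> y != 0 -> x ^+ 2 / y ^+ 2 = (i * x) ^+ 2 / (i * y) ^+ 2.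
      by move=> ? ?; field; apply/andP.
    have -> : - (z ^+ 2 / k.+1%:R ^+ 2) =
        - (((2 * pi)%:C * 'i * z) ^+ 2 / ((2 * pi)%:C * 'i * k.+1%:R) ^+ 2).
      by congr (- _); apply: h.
    apply: (@ccvg_ev R (fun M => - (((N M)%:R * sn (z / (N M)%:R)) ^+ 2 /
      ((N M)%:R * sn (k.+1%:R / (N M)%:R)) ^+ 2)) _ _ k.+1).
      move=> M kM; rewrite /a kM; congr (- _).
      have := hk M k kM.
      have p0 : 0 < 2 * (c * (pi * (k.+1%:R / (N M)%:R))) by rewrite !mulr_gt0 ?pi_gt0// invr_gt0.
      move=> /(lt_le_trans p0)/lt0r_neq0; rewrite nrm_eq0 => h0.
      by rewrite -h// pnatr_eq0.
    apply: ccvgN; apply: ccvgM; first exact: ccvgX.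
    by apply: ccvgV; [rewrite expf_neq0// mulf_neq0|exact: ccvgX].
  - move=> M; apply: (@ccvg_ev R (fun=> P M) _ _ M) (ccvg_cst _) => J MJ.
    rewrite /P -!(big_mkord xpredT (fun k => 1 + a M k)) [RHS](big_cat_nat (leq0n M) MJ) /=.
    rewrite [X in _ * X]big_nat_cond [X in _ * X]big1 ?mulr1// => i.
    by case/andP => /andP[Mi _] _; rewrite /a ltnNge Mi addr0.
  - exact: sc_ccvg.
apply: ccvg_unique (ccvgM hN PQ) _; apply: ccvg_ext (ccvg_cst (sn z)) => M.
have n0 : ((N M)%:R : C) != 0 by rewrite pnatr_eq0.
have -> : sn z = sn ((N M)%:R * (z / (N M)%:R)) by congr sn; field.
by rewrite sn_mulodd; congr (_ * _); apply: eq_bigr => k _; rewrite /a ltn_ord.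
Qed.

End SineProduct.

(** * The theta product and its rows *)

Section Theta.
Variable R : realType.
Local Notation C := R[i].
Implicit Types (u v w x y z q t : C).

(** Beyond some [J] all finite products of further factors stay within 1/2 of 1, so a vanishing
    limit would make the product of the first [J] factors vanish. *)
Lemma prod1D_neq0 (F : nat -> C) (t : nat -> R) (S : R) l :
  (forall n, nrm (F n) <= t n) -> (forall n, \sum_(i < n) t i <= S) ->
  (forall n, 1 + F n != 0) ->
  ccvg (fun n => \prod_(i < n) (1 + F i)) l -> l != 0.
Proof.
move=> Ft tS F0 hl.
have t0 n : 0 <= t n by apply: le_trans (nrm_ge0 _) (Ft n).
(* Chosen so that [expR S] times the tail is at most 1/2. *)
have e0 : 0 < (2 * expR S)^-1 by rewrite invr_gt0 mulr_gt0 ?expR_gt0.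
have [J hJ] := bounded_sum_tail t0 tS e0.
set P := \prod_(i < J) (1 + F i).
have P0 : P != 0 by apply/prodf_neq0 => i _.
have split n : \prod_(i < J + n) (1 + F i) = P * \prod_(i < n) (1 + F (J + i)%N).
  by rewrite big_split_ord.
have tail n : nrm (\prod_(i < n) (1 + F (J + i)%N) - 1) <= 2^-1.
  have hS m : \sum_(i < m) t (J + i)%N <= S.
    apply: le_trans (tS (J + m)%N); rewrite big_split_ord /= lerDr sumr_ge0// => i _.
  have := @nrm_prod_tail_le R (fun i => F (J + i)%N) (fun i => t (J + i)%N) S
     (fun i => Ft (J + i)%N) hS 0%N n (leq0n n).
  rewrite big_ord0 => /le_trans; apply.
  have := hJ J (J + n)%N (leqnn J) (leq_addr n J).
  rewrite -{1}(add0n J) big_addn addKn big_mkord => h.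
  apply: (@le_trans _ _ (expR S * (2 * expR S)^-1)).
    rewrite ler_wpM2l ?expR_ge0// big_mkord; apply: le_trans h.
    by under eq_bigr do rewrite addnC.
  by rewrite invfM mulrCA divff ?mulr1// gt_eqF ?expR_gt0.
apply: contra_neq P0 => l0; rewrite {}l0 in hl.
apply/eqP; rewrite -nrm_eq0 eq_le nrm_ge0 andbT; apply/ler_addgt0Pr => e ep.
have [N hN] := proj1 (ccvgP _ _) hl _ (divr_gt0 ep (ltr0n R 2)).
have := hN (J + N)%N (leq_addl _ _); rewrite subr0 split nrmM add0r => h.
have h2 : 2^-1 <= nrm (\prod_(i < N) (1 + F (J + i)%N)).
  have := tail N; have := nrmB (\prod_(i < N) (1 + F (J + i)%N)) (\prod_(i < N) (1 + F (J + i)%N) - 1).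
  rewrite opprB addrC subrK nrm1; lra.
have hP := nrm_ge0 P.
have : nrm P * 2^-1 < e / 2 by apply: le_lt_trans h; rewrite ler_wpM2l.
rewrite ltr_pM2r ?invr_gt0//; exact: ltW.
Qed.

Lemma geometric_bound (r : R) : 0 <= r < 1 -> forall n, \sum_(i < n) r ^+ i <= (1 - r)^-1.
Proof.
move=> /andP[r0 r1] n; rewrite -[leRHS]mul1r ler_pdivlMr ?subr_gt0//.
by rewrite mulrC -opprB mulNr -subrX1 opprB gerBl exprn_ge0.
Qed.

(* [(x q; q)_oo] *)
Definition Ep x q : C := limC (fun M => \prod_(m < M) (1 - x * q ^+ m.+1)).

Section Ep.
Variable q : C.
Hypothesis q1 : nrm q < 1.

Let bound x n : nrm (- (x * q ^+ n.+1)) <= nrm x * nrm q ^+ n.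
Proof.
rewrite nrmN nrmM nrmX ler_wpM2l ?nrm_ge0// exprS ler_piMl ?exprn_ge0 ?nrm_ge0//.
exact: ltW.
Qed.

Let sumbound x n : \sum_(i < n) nrm x * nrm q ^+ i <= nrm x * (1 - nrm q)^-1.
Proof. by rewrite -mulr_sumr ler_wpM2l ?nrm_ge0// geometric_bound// nrm_ge0. Qed.

Lemma Ep_ccvg x : ccvg (fun M => \prod_(m < M) (1 - x * q ^+ m.+1)) (Ep x q).
Proof.
have [l hl] := prod1D_ccvg (bound x) (sumbound x).
by rewrite /Ep (limC_ccvg hl).
Qed.

Lemma Ep_neq0 x : (forall m, 1 - x * q ^+ m.+1 != 0) -> Ep x q != 0.
Proof.
by move=> h; apply: (prod1D_neq0 (bound x) (sumbound x) h); exact: Ep_ccvg.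
Qed.

Lemma Ep1_neq0 : Ep 1 q != 0.
Proof.
apply: Ep_neq0 => m; rewrite mul1r subr_eq0 eq_sym; apply/negP => /eqP h.
have : nrm q ^+ m.+1 < 1 by rewrite exprn_ilt1 ?nrm_ge0.
by rewrite -nrmX h nrm1 ltxx.
Qed.

Lemma Ep_shift x : (1 - x * q) * Ep (x * q) q = Ep x q.
Proof.
apply: ccvg_unique (ccvgM (ccvg_cst (1 - x * q)) (Ep_ccvg (x * q))) _.
have := ccvg_sub leqnSn (Ep_ccvg x); apply: ccvg_ext => n.
rewrite big_ord_recl /= expr1; congr (_ * _); apply: eq_bigr => i _.
by rewrite /bump /= add1n exprS mulrA.
Qed.

End Ep.

Definition Ee u t : C := Ep (ce u) (ce t) * Ep (ce (- u)) (ce t) / Ep 1 (ce t) ^+ 2.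
(* [theta_1(u; t) / eta(t)^3] up to a constant; [Phi] is normalised to be 1 at [u = 0]. *)
Definition phi u t : C := sn u * Ee u t.
Definition Phi u t : C := sc u * Ee u t.

Lemma phiE u t : phi u t = (2 * pi)%:C * 'i * u * Phi u t.
Proof. by rewrite /phi /Phi mulrA sine_product. Qed.

Lemma Ee_ccvg u t : 0 < complex.Im t ->
  ccvg (fun M => \prod_(m < M) ((1 - ce u * ce t ^+ m.+1) *
     (1 - ce (- u) * ce t ^+ m.+1) / (1 - ce t ^+ m.+1) ^+ 2)) (Ee u t).
Proof.
move=> t0; have q1 := nrm_ce_lt1 t0.
have h := ccvgM (ccvgM (Ep_ccvg q1 (ce u)) (Ep_ccvg q1 (ce (- u))))
  (ccvgV (expf_neq0 2 (Ep1_neq0 q1)) (ccvgX 2 (Ep_ccvg q1 1))).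
apply: ccvg_ext h => M; rewrite -prodrXl -prodfV -!big_split /=.
by apply: eq_bigr => i _; rewrite mul1r.
Qed.

(** Apply the sine product to [w + u], [w - u] and [w]. The factors regroup because [(n^2 - (w +
    u)^2) (n^2 - (w - u)^2) = ((w + n)^2 - u^2) ((w - n)^2 - u^2)]. *)
Lemma row_product u w : sn w != 0 ->
  ccvg (fun N => (1 - u ^+ 2 / w ^+ 2) *
     \prod_(n < N) ((1 - u ^+ 2 / (w + n.+1%:R) ^+ 2) * (1 - u ^+ 2 / (w - n.+1%:R) ^+ 2)))
   (sn (w + u) * sn (w - u) / sn w ^+ 2).
Proof.
move=> sw.
have wn (n : int) : w + n%:~R != 0.
  apply: contra_neq sw => h.
  have := snDint w n; rewrite h sn0 => /esym/eqP; rewrite mulf_eq0 => /orP[|/eqP//].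
  by rewrite expfz_eq0 oppr_eq0 oner_eq0 andbF.
have w0 : w != 0 by have := wn 0; rewrite addr0.
have c0 : ((2 * pi)%:C * 'i : C) != 0.
  rewrite -nrm_eq0 nrmM nrm_real /nrm /= expr0n add0r expr1n sqrtr1 mulr1 normr_eq0.
  by rewrite mulf_neq0 ?lt0r_neq0 ?pi_gt0.
have scw : sc w != 0 by apply: contra_neq sw; rewrite -sine_product => ->; rewrite mulr0.
rewrite -!sine_product; move: ((2 * pi)%:C * 'i) c0 => c c0.
have -> : c * (w + u) * sc (w + u) * (c * (w - u) * sc (w - u)) / (c * w * sc w) ^+ 2 =
  (1 - u ^+ 2 / w ^+ 2) * (sc (w + u) * sc (w - u) / sc w ^+ 2).
  by field; rewrite c0 w0 scw.
apply: ccvgM; first exact: ccvg_cst.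
have h := ccvgM (ccvgM (sc_ccvg (w + u)) (sc_ccvg (w - u)))
  (ccvgV (expf_neq0 2 scw) (ccvgX 2 (sc_ccvg w))).
apply: ccvg_ext h => N; rewrite -prodrXl -prodfV -!big_split /=.
apply: eq_bigr => n _.
have h1 := wn n.+1; have h2 := wn (- n.+1%:Z); rewrite mulrNz in h2.
have h3 : (n.+1%:R : C) != 0 by rewrite pnatr_eq0.
move: h1 h2 h3; rewrite -![(n.+1%:Z)%:~R]/(n.+1%:R); move: (n.+1%:R : C) => k h1 h2 h3.
field; rewrite h1 h2 h3 /=.
have -> : k ^+ 2 - w ^+ 2 = - ((w + k) * (w - k)) by ring.
by rewrite oppr_eq0 mulf_neq0.
Qed.

(** So each factor of [Ee] is the product over one lattice row [(m + 1) t + Z]; the opposite row has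
    the same squares, and [sc] accounts for the row of the integers. Thus [Phi] is the half lattice
    product taken row by row. *)
Lemma row_product_q u t m : 0 < complex.Im t -> let w := m.+1%:R * t in
  ccvg (fun N => (1 - u ^+ 2 / w ^+ 2) *
     \prod_(n < N) ((1 - u ^+ 2 / (w + n.+1%:R) ^+ 2) * (1 - u ^+ 2 / (w - n.+1%:R) ^+ 2)))
   ((1 - ce u * ce t ^+ m.+1) * (1 - ce (- u) * ce t ^+ m.+1) / (1 - ce t ^+ m.+1) ^+ 2).
Proof.
move=> t0 w.
have qw : 1 - ce w != 0.
  rewrite subr_eq0 eq_sym; apply/negP => /eqP h.
  have : 0 < complex.Im w by rewrite /w -(rmorph_nat (real_complex R)) Im_realM mulr_gt0.
  by move/nrm_ce_lt1; rewrite h nrm1 ltxx.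
have sw : sn w != 0 by rewrite snE mulf_neq0 ?ce_neq0// -opprB oppr_eq0.
rewrite -ceMn -/w.
have -> : (1 - ce u * ce w) * (1 - ce (- u) * ce w) / (1 - ce w) ^+ 2 =
   sn (w + u) * sn (w - u) / sn w ^+ 2.
  rewrite !snE ![ce (_ + _)]ceD.
  have -> : ce (- ((w + u) / 2)) = ce (- (w / 2)) * ce (- (u / 2)).
    by rewrite -ceD; congr ce; field.
  have -> : ce (- ((w - u) / 2)) = ce (- (w / 2)) * ce (u / 2).
    by rewrite -ceD; congr ce; field.
  have -> : ce w - 1 = - (1 - ce w) by ring.
  have e1 := ce_neq0 (w / 2); have e2 := ce_neq0 (u / 2); have e3 := ce_neq0 u.
  rewrite !ceN; field.
  by rewrite qw e1 e2 e3.
exact: row_product.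
Qed.

End Theta.

(** * Exchange of rows and columns under t -> -1/t *)

Section Inversion.
Variable R : realType.
Local Notation C := R[i].
Implicit Types (u v w x y z q t : C).

(** The finite row products differ from 1 by at most a constant over [(m + 1)^2], uniformly in [N];
    hence [N] may tend to infinity under the product over [m]. *)
Lemma prod_exchange (b : nat -> nat -> C) (K : R) :
  (forall m n, nrm (b m n - 1) <= K / m.+1%:R ^+ 2 / n.+1%:R ^+ 2) ->
  exists (Br Bc : nat -> C) (D : C),
  [/\ forall m, ccvg (fun N => \prod_(n < N) b m n) (Br m),
      forall n, ccvg (fun M => \prod_(m < M) b m n) (Bc n),
      ccvg (fun M => \prod_(m < M) Br m) D & ccvg (fun N => \prod_(n < N) Bc n) D].
Proof.
move=> hb.
have K0 : 0 <= K.
  by apply: le_trans (nrm_ge0 _) (le_trans (hb 0%N 0%N) _); rewrite !expr1n !divr1.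
have inv1 n : (n.+1%:R ^+ 2 : R)^-1 <= 1 by rewrite invf_le1 ?exprn_gt0// exprn_ege1// ler1n.
have Kn0 n : 0 <= K / n.+1%:R ^+ 2 by rewrite divr_ge0 ?sqr_ge0.
have KnK n : K / n.+1%:R ^+ 2 <= K by rewrite ler_piMr.
have row (c : nat -> nat -> C) : (forall m n, nrm (c m n - 1) <= K / m.+1%:R ^+ 2 / n.+1%:R ^+ 2) ->
   forall m, exists l, ccvg (fun N => \prod_(n < N) c m n) l.
  move=> hc m; have [l hl] := prod1D_ccvg (hc m) (inv_sqr_bound (Kn0 m)).
  by exists l; apply: ccvg_ext hl => N; apply: eq_bigr => n _; rewrite addrC subrK.
have /choice [Br hBr] := row _ hb.
have hb' m n : nrm (b n m - 1) <= K / m.+1%:R ^+ 2 / n.+1%:R ^+ 2 by rewrite mulrAC hb.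
have /choice [Bc hBc] := row (fun n m => b m n) hb'.
pose K' := expR (K * 2) * (K * 2).
have K'0 : 0 <= K' by rewrite mulr_ge0 ?expR_ge0 ?mulr_ge0.
have fin m N : nrm (\prod_(n < N) b m n - 1) <= K' / m.+1%:R ^+ 2.
  have := @nrm_prod_tail_le R (fun n => b m n - 1) _ _ (hb m) (inv_sqr_bound (Kn0 m)) 0%N N (leq0n N).
  rewrite big_ord0; under eq_bigr do rewrite addrC subrK.
  move=> /le_trans; apply; rewrite big_mkord.
  apply: (@le_trans _ _ (expR (K * 2) * (K / m.+1%:R ^+ 2 * 2))).
    apply: ler_pM; rewrite ?expR_ge0 ?sumr_ge0//.
    - by move=> i _; rewrite divr_ge0 ?sqr_ge0.
    - by rewrite ler_expR ler_pM2r.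
    - exact: inv_sqr_bound.
  by rewrite /K' mulrAC -!mulrA.
have hBr1 m : nrm (Br m - 1) <= K' / m.+1%:R ^+ 2.
  by apply: ccvg_nrm_le (ccvgB (hBr m) (ccvg_cst 1)) => N; apply: fin.
have [D hD] := prod1D_ccvg hBr1 (inv_sqr_bound K'0).
exists Br, Bc, D; split => //.
  by apply: ccvg_ext hD => N; apply: eq_bigr => n _; rewrite addrC subrK.
apply: (@prod_dominated_ccvg R (fun N m => \prod_(n < N) b m n - 1) (fun m => Br m - 1)
  (fun m => K' / m.+1%:R ^+ 2) (K' * 2) _ D) => //.
- exact: inv_sqr_bound.
- by move=> m; apply: ccvgB (hBr m) (ccvg_cst 1).
move=> N; have := @ccvg_prod R N (fun n M => \prod_(m < M) b m n) Bc hBc.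
apply: ccvg_ext => M; rewrite exchange_big; apply: eq_bigr => m _ /=.
by rewrite addrC subrK.
Qed.

(** Both [|a|] and [|b|] are at most a constant times the modulus of the lattice point. In product
    form this bounds its inverse fourth power by a constant over [(m n)^2], the separated majorant
    of [prod_exchange]. *)
Lemma lattice_lower t : 0 < complex.Im t -> exists2 k : R, 0 < k &
  forall a b : R, k * (`|a| * `|b|) <= nrm (a%:C * t + b%:C) ^+ 2.
Proof.
move=> y0; set y := complex.Im t in y0 *; set x := complex.Re t.
pose k := y^-1 * (1 + `|x| / y).
have kp : 0 < k by rewrite mulr_gt0 ?invr_gt0// ltr_pwDl// divr_ge0// ltW.
exists k^-1; first by rewrite invr_gt0.
move=> a b; set o := a%:C * t + b%:C.
rewrite mulrC ler_pdivrMr//.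
have ha : `|a| <= nrm o * y^-1.
  rewrite ler_pdivlMr//; apply: le_trans (Im_le_nrm o).
  by rewrite /o cImD Im_realM /= addr0 normrM (gtr0_norm y0).
have hb : `|b| <= nrm o * (1 + `|x| / y).
  have h := Re_le_nrm o; rewrite /o cReD Re_realM /= in h; rewrite -/x -/o in h.
  have -> : b = (a * x + b) - a * x by ring.
  apply: le_trans (ler_normB _ _) _; rewrite mulrDr mulr1 lerD// normrM.
  by rewrite mulrA mulrAC; apply: ler_wpM2r.
apply: le_trans (ler_pM _ _ ha hb) _ => //.
by rewrite /k expr2 mulrACA.
Qed.

(* With [u^2 + v^2 + w^2 = 0] this is [1 + O(s^-2)], so that the product over the
   lattice of [s = omega^2] converges absolutely and can be taken in either order. *)
Definition tri u v w (s : C) := (1 - u ^+ 2 / s) * (1 - v ^+ 2 / s) * (1 - w ^+ 2 / s).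

(** The coefficient of [1 / o] in [tri - 1] is minus the sum of the squares, hence 0; [A] and [B]
    come from the other two symmetric functions. In use [o] is the square of a lattice point and [r]
    is [m n]. *)
Lemma tri_bound u v w : u ^+ 2 + v ^+ 2 + w ^+ 2 = 0 -> forall k : R, 0 < k ->
  exists2 K, 0 <= K & forall (o : C) (r : R), 1 <= r -> k * r <= nrm o ->
    nrm (tri u v w o - 1) <= K / r ^+ 2.
Proof.
move=> h k k0.
pose A := nrm (u ^+ 2 * v ^+ 2 + v ^+ 2 * w ^+ 2 + w ^+ 2 * u ^+ 2).
pose B := nrm (u ^+ 2 * v ^+ 2 * w ^+ 2).
have A0 : 0 <= A by apply: nrm_ge0.
have B0 : 0 <= B by apply: nrm_ge0.
exists ((A + B / k) / k ^+ 2).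
  by rewrite divr_ge0 ?sqr_ge0// addr_ge0// divr_ge0// ltW.
move=> o r r1 kr; have r0 : 0 < r by apply: lt_le_trans r1.
have on : 0 < nrm o by apply: lt_le_trans kr; rewrite mulr_gt0.
have o0 : o != 0 by rewrite -nrm_eq0 gt_eqF.
have -> : tri u v w o - 1 =
   (u ^+ 2 * v ^+ 2 + v ^+ 2 * w ^+ 2 + w ^+ 2 * u ^+ 2 - u ^+ 2 * v ^+ 2 * w ^+ 2 / o) / o ^+ 2.
  have -> : tri u v w o - 1 =
   (u ^+ 2 * v ^+ 2 + v ^+ 2 * w ^+ 2 + w ^+ 2 * u ^+ 2 - u ^+ 2 * v ^+ 2 * w ^+ 2 / o) / o ^+ 2
     - (u ^+ 2 + v ^+ 2 + w ^+ 2) / o by rewrite /tri; field.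
  by rewrite h mul0r subr0.
have ki : (nrm o)^-1 <= (k * r)^-1 by rewrite lef_pV2 ?posrE ?mulr_gt0.
have ki' : (nrm o)^-1 <= k^-1.
  by apply: le_trans ki _; rewrite lef_pV2 ?posrE ?mulr_gt0// ler_peMr// ltW.
rewrite nrmM nrmV nrmX -[(nrm o ^+ 2)^-1]exprVn.
have -> : (A + B / k) / k ^+ 2 / r ^+ 2 = (A + B / k) * (k * r)^-1 ^+ 2.
  by field; rewrite !lt0r_neq0.
apply: ler_pM; rewrite ?nrm_ge0 ?exprn_ge0 ?invr_ge0 ?nrm_ge0//.
  apply: le_trans (nrmB _ _) _; rewrite lerD2l nrmM nrmV ler_wpM2l//.
by rewrite lerXn2r ?nnegrE ?invr_ge0 ?nrm_ge0// ?mulr_ge0 ?ltW.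
Qed.

(** Each row splits into its point on the axis of multiples of [t], which together give the factors
    [sc (u / t)], and pairs of points off both axes, which [D] collects. *)
Lemma Ee_tri u v w t (Br : nat -> C) D : 0 < complex.Im t ->
  (forall m, ccvg (fun N => \prod_(n < N) (tri u v w ((m.+1%:R * t + n.+1%:R) ^+ 2) *
      tri u v w ((m.+1%:R * t - n.+1%:R) ^+ 2))) (Br m)) ->
  ccvg (fun M => \prod_(m < M) Br m) D ->
  Ee u t * Ee v t * Ee w t = sc (u / t) * sc (v / t) * sc (w / t) * D.
Proof.
move=> t0 hBr hD.
have tn0 : t != 0 by apply: contraTneq t0 => ->; rewrite /= ltxx.
have hX := ccvgM (ccvgM (sc_ccvg (u / t)) (sc_ccvg (v / t))) (sc_ccvg (w / t)).
apply: ccvg_unique (ccvgM (ccvgM (Ee_ccvg u t0) (Ee_ccvg v t0)) (Ee_ccvg w t0)) _.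
apply: ccvg_ext (ccvgM hX hD) => M; rewrite -!big_split /=.
apply: eq_bigr => m _.
have h := ccvgM (ccvgM (row_product_q u m t0) (row_product_q v m t0)) (row_product_q w m t0).
apply: ccvg_unique h.
have -> : (1 - (u / t) ^+ 2 / m.+1%:R ^+ 2) * (1 - (v / t) ^+ 2 / m.+1%:R ^+ 2) *
    (1 - (w / t) ^+ 2 / m.+1%:R ^+ 2) = tri u v w ((m.+1%:R * t) ^+ 2).
  have k0 : (m.+1%:R : C) != 0 by rewrite pnatr_eq0.
  by move: (m.+1%:R : C) k0 => k k0; rewrite /tri; field; rewrite k0 tn0.
apply: ccvg_ext (ccvgM (ccvg_cst (tri u v w ((m.+1%:R * t) ^+ 2))) (hBr m)) => N /=.
have aux (a b c d e f a' : C) : a' = a * c * e -> a' * (b * d * f) = a * b * (c * d) * (e * f).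
  by move=> ->; ring.
pose P x := \prod_(n < N) ((1 - x ^+ 2 / (m.+1%:R * t + n.+1%:R) ^+ 2) *
   (1 - x ^+ 2 / (m.+1%:R * t - n.+1%:R) ^+ 2)).
rewrite (_ : \prod_(n < N) _ = P u * P v * P w); first exact: aux.
rewrite -!big_split /=; apply: eq_bigr => n _; rewrite /tri.
by rewrite mulrACA -!mulrA; congr (_ * _); ring.
Qed.

Lemma Im_invN t : 0 < complex.Im t -> 0 < complex.Im (- t^-1).
Proof.
case: t => a b /= b0; rewrite opprK divr_gt0// ltr_wpDl ?sqr_ge0// exprn_gt0//.
Qed.

(** The points for [- 1 / t] are those for [t] divided by [t], with rows and columns exchanged. So
    the same [D] occurs on both sides, while [sc u] and [sc (u / t)] trade places; both sides are
    the product of all six values of [sc] and [D]. *)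
Lemma Phi_tri u v w t : 0 < complex.Im t -> u ^+ 2 + v ^+ 2 + w ^+ 2 = 0 ->
  Phi u t * Phi v t * Phi w t =
  Phi (u / t) (- t^-1) * Phi (v / t) (- t^-1) * Phi (w / t) (- t^-1).
Proof.
move=> t0 uvw; have t0' := Im_invN t0.
have tn0 : t != 0 by apply: contraTneq t0 => ->; rewrite /= ltxx.
pose b m n := tri u v w ((m.+1%:R * t + n.+1%:R) ^+ 2) *
      tri u v w ((m.+1%:R * t - n.+1%:R) ^+ 2).
have dv x y : (x / t) ^+ 2 / (y / t ^+ 2) = x ^+ 2 / y.
  by rewrite expr_div_n [(y / _)^-1]invfM invrK mulrACA mulVf ?expf_neq0 ?mulr1.
have [k k0 hk] := lattice_lower t0.
have [K K0 hK] := tri_bound uvw k0.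
have one (m n : nat) (s : R) : `|s| = n.+1%:R ->
   nrm (tri u v w ((m.+1%:R * t + s%:C) ^+ 2) - 1) <= K / (m.+1%:R * n.+1%:R) ^+ 2.
  move=> sn; apply: hK; first by rewrite -natrM ler1n.
  have := hk m.+1%:R s; rewrite sn normr_nat nrmX.
  by rewrite (rmorph_nat (real_complex R)).
have hb m n : nrm (b m n - 1) <= (K ^+ 2 + 2 * K) / m.+1%:R ^+ 2 / n.+1%:R ^+ 2.
  have h1 := one m n n.+1%:R (normr_nat _ _).
  have := one m n (- n.+1%:R); rewrite normrN normr_nat => /(_ erefl) h2.
  rewrite rmorphN /= in h2; rewrite (rmorph_nat (real_complex R)) in h1 h2.
  rewrite /b; set r1 := tri _ _ _ _ in h1 *; set r2 := tri _ _ _ _ in h2 *.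
  rewrite -mulrA -invfM -exprMn.
  have L1 : (((m.+1%:R * n.+1%:R) ^+ 2)^-1 : R) <= 1.
    by rewrite invf_le1 ?exprn_gt0 ?mulr_gt0// exprn_ege1// -natrM ler1n.
  have L0 : 0 <= (((m.+1%:R * n.+1%:R) ^+ 2)^-1 : R) by rewrite invr_ge0 sqr_ge0.
  move: h1 h2 L1 L0; set e := ((_ * _) ^+ 2)^-1 => h1 h2 L1 L0.
  have -> : r1 * r2 - 1 = (r1 - 1) * (r2 - 1) + (r1 - 1) + (r2 - 1) by ring.
  apply: le_trans (nrmD _ _) _; apply: le_trans (lerD (nrmD _ _) (lexx _)) _.
  rewrite nrmM.
  have h12 : nrm (r1 - 1) * nrm (r2 - 1) <= K * K * e.
    apply: le_trans (ler_pM (nrm_ge0 _) (nrm_ge0 _) h1 h2) _.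
    by rewrite mulrACA -[leRHS]mulr1 -[K * K * e * 1]mulrA ler_wpM2l ?mulr_ge0// mulr1 ler_piMl.
  have -> : (K ^+ 2 + 2 * K) * e = K * K * e + K * e + K * e by ring.
  by rewrite !lerD.
have [Br [Bc [D [hBr hBc hD1 hD2]]]] := prod_exchange hb.
have E1 := Ee_tri t0 hBr hD1.
have E2 : Ee (u / t) (- t^-1) * Ee (v / t) (- t^-1) * Ee (w / t) (- t^-1) =
    sc (u / t / - t^-1) * sc (v / t / - t^-1) * sc (w / t / - t^-1) * D.
  apply: (@Ee_tri _ _ _ _ Bc) => // n; apply: ccvg_ext (hBc n) => M.
  apply: eq_bigr => m _; rewrite /b mulrC; congr (_ * _).
    rewrite /tri.
    have -> : (n.+1%:R * - t^-1 + m.+1%:R) ^+ 2 = (m.+1%:R * t - n.+1%:R) ^+ 2 / t ^+ 2 by field.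
    by rewrite !dv.
  rewrite /tri.
  have -> : (n.+1%:R * - t^-1 - m.+1%:R) ^+ 2 = (m.+1%:R * t + n.+1%:R) ^+ 2 / t ^+ 2 by field.
  by rewrite !dv.
have scN x : sc (x / t / - t^-1) = sc x.
  rewrite invrN invrK mulrN divfK// /sc; congr limC; apply/funext => J.
  by rewrite sqrrN.
rewrite !scN in E2; rewrite /Phi.
have aux (x1 x2 x3 y1 y2 y3 x1' x2' x3' y1' y2' y3' : C) :
    y1 * y2 * y3 = x1' * x2' * x3' * D -> y1' * y2' * y3' = x1 * x2 * x3 * D ->
    x1 * y1 * (x2 * y2) * (x3 * y3) = x1' * y1' * (x2' * y2') * (x3' * y3').
  by move=> h h'; ring: h h'.
exact: (aux _ _ _ _ _ _ _ _ _ _ _ _ E1 E2).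
Qed.

End Inversion.

(** * Quasi-periods and zeros of theta; its inversion formula *)

Section Inversion2.
Variable R : realType.
Local Notation C := R[i].
Implicit Types (u v w x y z q t : C).

Lemma Phi0 t : 0 < complex.Im t -> Phi 0 t = 1.
Proof.
move=> t0; rewrite /Phi sc0 mul1r /Ee oppr0 ce0 -expr2 divff//.
by rewrite expf_neq0// Ep1_neq0// nrm_ce_lt1.
Qed.

Lemma EeN u t : Ee (- u) t = Ee u t.
Proof. by rewrite /Ee opprK [Ep (ce (- u)) _ * _]mulrC. Qed.

Lemma phiN u t : phi (- u) t = - phi u t.
Proof. by rewrite /phi snN EeN mulNr. Qed.

Lemma phiDint u t (n : int) : phi (u + n%:~R) t = (-1) ^ n * phi u t.
Proof.
have h : ce (- (u + n%:~R)) = ce (- u) by rewrite opprD -mulrNz ceDint.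
by rewrite /phi /Ee snDint h ceDint -[LHS]mulrA.
Qed.

(** Under [u -> u + t] one of the two products in [Ee] loses a factor and the other gains one; with
    [sn] they combine to a monomial. *)
Lemma phiDt u t : 0 < complex.Im t -> phi (u + t) t = - ce (- u - t / 2) * phi u t.
Proof.
move=> t0; have q1 := nrm_ce_lt1 t0; rewrite /phi /Ee.
have h1 := Ep_shift q1 (ce u); rewrite -ceD in h1.
have h2 := Ep_shift q1 (ce (- (u + t))).
have e1 : ce (- (u + t)) * ce t = ce (- u) by rewrite -ceD; congr ce; ring.
rewrite e1 in h2; rewrite -h1 -h2 snE snE'.
have -> : ce (- ((u + t) / 2)) = ce (- u - t / 2) * ce (u / 2).
  by rewrite -ceD; congr ce; field.
by ring.
Qed.

Lemma phiDtn u t (l : nat) : 0 < complex.Im t ->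
  phi (u + l%:R * t) t = (-1) ^+ l * ce (- (l%:R * u) - l%:R ^+ 2 * t / 2) * phi u t.
Proof.
move=> t0; elim: l => [|l IH].
  by rewrite [0 ^+ 2]expr0n /= !mul0r !oppr0 !addr0 ce0 expr0 !mul1r.
have -> : u + l.+1%:R * t = (u + l%:R * t) + t by rewrite -natr1; ring.
rewrite phiDt// IH [(-1) ^+ l.+1]exprS.
have -> : ce (- (l.+1%:R * u) - l.+1%:R ^+ 2 * t / 2) =
    ce (- (u + l%:R * t) - t / 2) * ce (- (l%:R * u) - l%:R ^+ 2 * t / 2).
  by rewrite -ceD; congr ce; rewrite -natr1; field.
ring.
Qed.

Definition inlat t x := exists m n : int, x = m%:~R * t + n%:~R.

Lemma inlatD t x y : inlat t x -> inlat t y -> inlat t (x + y).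
Proof.
by move=> [m [n ->]] [m' [n' ->]]; exists (m + m'), (n + n'); rewrite !intrD; ring.
Qed.

Lemma inlatMz t x (k : int) : inlat t x -> inlat t (k%:~R * x).
Proof. by move=> [m [n ->]]; exists (k * m), (k * n); rewrite !intrM; ring. Qed.

Lemma inlat_int t (n : int) : inlat t n%:~R.
Proof. by exists 0, n; rewrite mul0r add0r. Qed.

Lemma phi_eq0 u t : 0 < complex.Im t -> phi u t = 0 -> inlat t u.
Proof.
move=> t0; have q1 := nrm_ce_lt1 t0.
move/eqP; rewrite /phi /Ee mulf_eq0 => /orP[/eqP/sn_eq0 [n ->]|]; first exact: inlat_int.
rewrite mulf_eq0 invr_eq0 expf_eq0 /= (negbTE (Ep1_neq0 q1)) orbF mulf_eq0.
have key x : Ep (ce x) (ce t) == 0 -> inlat t x.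
  move=> h0; have [m hm] : exists m, 1 - ce x * ce t ^+ m.+1 = 0.
    apply: contrapT => no; have : Ep (ce x) (ce t) != 0.
      by apply: Ep_neq0 => // m; apply/eqP => hm; apply: no; exists m.
    by rewrite h0.
  move/eqP: hm; rewrite subr_eq0 -ceMn -ceD eq_sym => /eqP /ce_eq1 [n hn].
  by exists (- m.+1%:Z), n; rewrite -hn mulrNz -[(m.+1%:Z)%:~R]/(m.+1%:R); ring.
move=> /orP[/key//|/key /(inlatMz (-1))].
by rewrite mulN1r opprK.
Qed.

Lemma inlat_small t : 0 < complex.Im t -> exists2 d : R, 0 < d &
  forall x, inlat t x -> nrm x < d -> x = 0.
Proof.
move=> t0; exists (Num.min 1 (complex.Im t)); first by rewrite lt_min ltr01.
move=> _ [m [n ->]]; rewrite lt_min => /andP[h1 h2].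
have mE : (m%:~R : C) = (m%:~R : R)%:C by rewrite rmorph_int.
have nE : (n%:~R : C) = (n%:~R : R)%:C by rewrite rmorph_int.
have m0 : m = 0.
  have := le_lt_trans (Im_le_nrm _) h2; rewrite mE nE cImD Im_realM /= addr0 normrM.
  rewrite (gtr0_norm t0) gtr_pMl// -intr_norm -[1]/(1%:~R) ltr_int; lia.
rewrite m0 mul0r add0r nE nrm_real -intr_norm -[1]/(1%:~R) ltr_int in h1 *.
have -> : n = 0 by lia.
by [].
Qed.

Lemma Phi_neq0 u t : 0 < complex.Im t -> ~ inlat t u -> Phi u t != 0.
Proof.
by move=> t0 h; apply/eqP => p0; apply: h; apply: phi_eq0 => //; rewrite phiE p0 mulr0.
Qed.

(** The value [r] solves [u^2 = (r + N)^2 - r^2], and the two conditions keep [Phi] from vanishing.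
    For large [N], a lattice point [r] would make [2 r + N = u^2 / N] a lattice point that is
    nonzero but too small. If the second condition fails at [N], it holds at [2 N]: otherwise a
    combination of the two points would be [3 i u^2 / (2 N)], again too small. *)
Lemma good_shift u t : 0 < complex.Im t -> u != 0 -> exists n : nat,
  let r := (u ^+ 2 - n.+1%:R ^+ 2) / (2 * n.+1%:R) in
  ~ inlat t r /\ ~ inlat t ('i * (r + n.+1%:R)).
Proof.
move=> t0 u0; have [d d0 hd] := inlat_small t0.
have [n hn] : exists n : nat, 2 * nrm u ^+ 2 / d < n.+1%:R.
  exists (Num.truncn (2 * nrm u ^+ 2 / d)).
  by rewrite truncnS_gt.
have up : 0 < nrm u by rewrite lt_def nrm_eq0 u0 nrm_ge0.
have small k : (n <= k)%N -> 2 * nrm u ^+ 2 / k.+1%:R < d.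
  move=> nk; rewrite ltr_pdivrMr// [d * _]mulrC -ltr_pdivrMr//; apply: lt_le_trans hn _.
  by rewrite ler_nat ltnS.
have bad1 k : (n <= k)%N -> ~ inlat t ((u ^+ 2 - k.+1%:R ^+ 2) / (2 * k.+1%:R)).
  move=> nk h; have k0 : (k.+1%:R : C) != 0 by rewrite pnatr_eq0.
  have h1 := inlatD (inlatMz 2 h) (inlat_int t k.+1).
  have e1 : 2%:~R * ((u ^+ 2 - k.+1%:R ^+ 2) / (2 * k.+1%:R)) + (k.+1%:Z)%:~R = u ^+ 2 / k.+1%:R.
    by rewrite -[(k.+1%:Z)%:~R]/(k.+1%:R : C); move: (k.+1%:R : C) k0 => K K0; field.
  rewrite e1 in h1; have := hd _ h1.
  have s1 := small k nk; rewrite nrmM nrmV nrmX nrm_nat.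
  have le1 : nrm u ^+ 2 / k.+1%:R <= 2 * nrm u ^+ 2 / k.+1%:R.
    by rewrite ler_pM2r ?invr_gt0// ler_peMl ?sqr_ge0 ?ler1n.
  move=> /(_ (le_lt_trans le1 s1)) /eqP; apply/negP.
  by rewrite mulf_neq0 ?expf_neq0 ?invr_neq0.
have bad2 : inlat t ('i * ((u ^+ 2 - n.+1%:R ^+ 2) / (2 * n.+1%:R) + n.+1%:R)) ->
   ~ inlat t ('i * ((u ^+ 2 - (n.*2.+2)%:R ^+ 2) / (2 * (n.*2.+2)%:R) + (n.*2.+2)%:R)).
  move=> h1 h2; have k0 : (n.+1%:R : C) != 0 by rewrite pnatr_eq0.
  have h3 := inlatD (inlatMz 4 h1) (inlatMz (-2) h2).
  have e1 : 4%:~R * ('i * ((u ^+ 2 - n.+1%:R ^+ 2) / (2 * n.+1%:R) + n.+1%:R)) +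
     (-2)%:~R * ('i * ((u ^+ 2 - (n.*2.+2)%:R ^+ 2) / (2 * (n.*2.+2)%:R) + (n.*2.+2)%:R)) =
     3 / 2 * 'i * u ^+ 2 / n.+1%:R.
    have -> : ((n.*2.+2)%:R : C) = 2 * n.+1%:R by rewrite -natrM; congr (_%:R); lia.
    by move: (n.+1%:R : C) k0 => K K0; rewrite mulrNz; field.
  rewrite e1 in h3; have := hd _ h3.
  have ni : nrm ('i : C) = 1 by rewrite /nrm /= expr0n add0r expr1n sqrtr1.
  have s1 := small n (leqnn n); rewrite nrmM [nrm (_ * u ^+ 2)]nrmM nrmX.
  rewrite [nrm (3 / 2 * 'i)]nrmM ni [nrm (3 / 2)]nrmM !nrmV !nrm_nat mulr1.
  have le1 : 3 / 2 * nrm u ^+ 2 / n.+1%:R <= 2 * nrm u ^+ 2 / n.+1%:R.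
    by rewrite ler_pM2r ?invr_gt0// ler_wpM2r ?sqr_ge0//; lra.
  move=> /(_ (le_lt_trans le1 s1)) /eqP; apply/negP.
  rewrite !mulf_neq0 ?expf_neq0 ?invr_neq0 ?pnatr_eq0//.
  by rewrite -nrm_eq0 ni oner_eq0.
have [h|h] := pselect (inlat t ('i * ((u ^+ 2 - n.+1%:R ^+ 2) / (2 * n.+1%:R) + n.+1%:R))).
  exists n.*2.+1; split; last exact: bad2.
  by apply: bad1; lia.
by exists n; split => //; apply: bad1.
Qed.

(* Both sides are multiplicative in [u ^+ 2] by [Phi_tri], and their quotient is
   invariant under [u |-> u + n]; since [u ^+ 2 = (r + n) ^+ 2 - r ^+ 2] for a
   suitable [r], the quotient is 1. *)
Lemma Phi_inv u t : 0 < complex.Im t ->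
  Phi (u / t) (- t^-1) * ce (- (u ^+ 2 / (2 * t))) = Phi u t.
Proof.
move=> t0; have t0' := Im_invN t0.
have tn0 : t != 0 by apply: contraTneq t0 => ->; rewrite /= ltxx.
have [->|u0] := eqVneq u 0.
  by rewrite mul0r expr0n /= mul0r oppr0 ce0 !Phi0// mulr1.
pose Psi x := Phi (x / t) (- t^-1) * ce (- (x ^+ 2 / (2 * t))).
rewrite -[LHS]/(Psi u).
have tri3 x y z : x ^+ 2 + y ^+ 2 + z ^+ 2 = 0 ->
    Psi x * Psi y * Psi z = Phi x t * Phi y t * Phi z t.
  move=> h; rewrite (Phi_tri t0 h) /Psi.
  have h' : ce (- (x ^+ 2 / (2 * t))) * ce (- (y ^+ 2 / (2 * t))) * ce (- (z ^+ 2 / (2 * t))) = 1.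
    rewrite -!ceD -!opprD -!mulrDl h mul0r oppr0 ce0 //.
  by ring: h'.
have Psi0 : Psi 0 = 1 by rewrite /Psi mul0r expr0n /= mul0r oppr0 ce0 Phi0// mulr1.
have [n] := good_shift t0 u0; set r := _ / _; set N := n.+1%:R => -[h1 h2].
have N0 : N != 0 by rewrite pnatr_eq0.
(* Both [u^2 + r^2 + v^2] and [(r + N)^2 + v^2] vanish, so the multiplicative relation links [u]
   with [r] and [v], and [v] with [r + N]. *)
set v := 'i * (r + N) in h2.
have iv : v ^+ 2 = - (r + N) ^+ 2 by rewrite /v exprMn sqr_i mulN1r.
have e1 : Psi u * Psi r * Psi v = Phi u t * Phi r t * Phi v t.
  by apply: tri3; rewrite iv /r; field.
have e2 : Psi (r + N) * Psi v = Phi (r + N) t * Phi v t.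
  have := tri3 0 (r + N) v; rewrite Psi0 Phi0// !mul1r; apply.
  by rewrite iv expr0n /= add0r subrr.
have c0 : ((2 * pi)%:C * 'i : C) != 0.
  rewrite -nrm_eq0 nrmM nrm_real /nrm /= expr0n add0r expr1n sqrtr1 mulr1 normr_eq0.
  by rewrite mulf_neq0 ?lt0r_neq0 ?pi_gt0.
set s : C := (-1) ^+ n.+1.
have ss : s * s = 1 by rewrite /s -expr2 sqrr_sign.
have e3 : r * Phi r t = s * ((r + N) * Phi (r + N) t).
  have := phiDint r t n.+1; rewrite -[(n.+1%:Z)%:~R]/N -[(-1) ^ _]/s !phiE => h.
  have cancel (c a b P P' : C) : c != 0 -> c * b * P' = s * (c * a * P) -> a * P = s * (b * P').
    move=> cn0 hc; apply: (mulfI cn0); rewrite (_ : c * (s * (b * P')) = s * (c * b * P')); last by ring.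
    by rewrite hc; ring: ss.
  exact: cancel c0 h.
(* For the modulus [- t^-1], passing from [r + N] to [r] is a shift by [N] quasi-periods, whose
   exponential factor is exactly compensated by the Gaussian in [Psi]. *)
have e4 : r * Psi r = s * ((r + N) * Psi (r + N)).
  have := phiDtn ((r + N) / t) n.+1 t0'; rewrite -/N -/s !phiE => h.
  have rE : (r + N) / t + N * - t^-1 = r / t by field.
  rewrite rE in h; apply: (mulfI c0); rewrite /Psi.
  have -> : ce (- ((r + N) ^+ 2 / (2 * t))) =
     ce (- (N * ((r + N) / t)) - N ^+ 2 * - t^-1 / 2) * ce (- (r ^+ 2 / (2 * t))).
    by rewrite -ceD; congr ce; field.
  rewrite (_ : _ * (r * _) = ((2 * pi)%:C * 'i * (r / t) * Phi (r / t) (- t^-1)) * (t * ce (- (r ^+ 2 / (2 * t))))); last first.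
    by move: ((2 * pi)%:C * 'i) => c; field.
  rewrite h; move: ((2 * pi)%:C * 'i) => c; move: (Phi _ _) (ce _) (ce _) => A B D.
  by field.
have r0 : r != 0 by apply: contra_not_neq h1 => ->; exact: (inlat_int t 0).
have e5 : Psi r * Psi v = Phi r t * Phi v t.
  apply: (mulfI r0); rewrite mulrA e4 [RHS]mulrA e3 -[LHS]mulrA -[RHS]mulrA.
  by congr (s * _); rewrite -[LHS]mulrA -[RHS]mulrA e2.
have nz : Phi r t * Phi v t != 0 by rewrite mulf_neq0// Phi_neq0.
have fin (x y z x' y' z' : C) : y * z = y' * z' -> y' * z' != 0 ->
    x * y * z = x' * y' * z' -> x = x'.
  by move=> yz n0; rewrite -!mulrA yz => /(mulIf n0).
exact: fin e5 nz e1.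
Qed.

Lemma phi_inv u t : 0 < complex.Im t ->
  t * phi (u / t) (- t^-1) = ce (u ^+ 2 / (2 * t)) * phi u t.
Proof.
move=> t0; have tn0 : t != 0 by apply: contraTneq t0 => ->; rewrite /= ltxx.
rewrite !phiE -[Phi u t]Phi_inv//; set c := _%:C * 'i; set e := u ^+ 2 / _.
rewrite (_ : t * (c * (u / t) * _) = c * u * Phi (u / t) (- t^-1)); last by field.
by ring: (ce_mulN e).
Qed.

End Inversion2.

(** * The crank generating function as a power series *)

Section CrankSeries.
Variable R : realType.
Local Notation C := R[i].
Implicit Types (x y q : C) (P Q : {poly C}).

Definition agree n P Q := forall i, (i <= n)%N -> P`_i = Q`_i.

Lemma agreeM n P P' Q Q' : agree n P P' -> agree n Q Q' -> agree n (P * Q) (P' * Q').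
Proof.
move=> hP hQ i ni; rewrite !coefM; apply: eq_bigr => j _.
by rewrite hP ?hQ//; have := ltn_ord j; lia.
Qed.

Lemma agree_prod n (r : seq nat) (F G : nat -> {poly C}) :
  (forall i, i \in r -> agree n (F i) (G i)) ->
  agree n (\prod_(i <- r) F i) (\prod_(i <- r) G i).
Proof.
elim: r => [|a r IH] h; first by rewrite !big_nil.
rewrite !big_cons; apply: agreeM; first by apply: h; rewrite inE eqxx.
by apply: IH => i ir; apply: h; rewrite inE ir orbT.
Qed.

Lemma agree_geom n y (k N K : nat) : (K <= N)%N -> (n < k * K.+1)%N ->
  agree n (\sum_(j < N.+1) (y ^+ j)%:P * 'X^(k * j)) (\sum_(j < K.+1) (y ^+ j)%:P * 'X^(k * j)).
Proof.
move=> KN nk i ni.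
rewrite -!(big_mkord xpredT (fun j => (y ^+ j)%:P * 'X^(k * j))).
rewrite (big_cat_nat (leq0n K.+1)) ?ltnS//= coefD [X in _ + X](_ : _ = 0) ?addr0//.
rewrite coef_sum big_nat_cond big1// => j /andP[/andP[Kj _] _].
rewrite coefCM coefXn (_ : (i == k * j)%N = false) ?mulr0//.
apply/eqP => ij; have : (k * K.+1 <= k * j)%N by rewrite leq_mul2l Kj orbT.
by rewrite -ij leqNgt => /negP; apply; apply: leq_ltn_trans nk.
Qed.

(** Factors with [k > n] are 1 modulo [X^(n+1)]; for [k <= n], longer geometric sums change only
    degrees above [n]. *)
Lemma crank_trunc_coef x n N : (n <= N)%N -> (crank_trunc x N)`_n = (crank_trunc x n)`_n.
Proof.
move=> nN; rewrite /crank_trunc (@big_cat_nat _ _ _ n.+1)//=.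
set A := \prod_(1 <= k < n.+1) _; set B := \prod_(n.+1 <= k < N.+1) _.
set A' := \prod_(1 <= k < n.+1) _.
have hA : agree n A A'.
  apply: agree_prod => k; rewrite mem_index_iota => /andP[k1 kn].
  by apply: agreeM; [apply: agreeM => //|]; apply: agree_geom => //; nia.
have hB : agree n B 1.
  suff : agree n B (\prod_(n.+1 <= k < N.+1) 1) by rewrite big1_eq.
  apply: agree_prod => k; rewrite mem_index_iota => /andP[k1 kn].
  have g y : agree n (\sum_(j < N.+1) (y ^+ j)%:P * 'X^(k * j)) 1.
    have := @agree_geom n y k N 0 (leq0n N).
    by rewrite muln1 big_ord1 muln0 expr0 mulr1 => /(_ k1).
  rewrite -[X in agree n _ X]mulr1 -[X in agree n _ (X * _)]mulr1.
  apply: agreeM => //; apply: agreeM => // i ni.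
  by rewrite coefB coefXn (_ : (i == k)%N = false) ?subr0//; lia.
by have := agreeM hA hB (leqnn n); rewrite mulr1.
Qed.

Definition dominated P (Q : {poly R}) := forall i, nrm P`_i <= Q`_i.

Lemma dominatedM P P' (Q Q' : {poly R}) : dominated P Q -> dominated P' Q' ->
  dominated (P * P') (Q * Q').
Proof.
move=> h h' i; rewrite !coefM; apply: le_trans (nrm_sum _ _ _) _.
by apply: ler_sum => j _; rewrite nrmM ler_pM ?nrm_ge0.
Qed.

Lemma dominated_prod (r : seq nat) (F : nat -> {poly C}) (G : nat -> {poly R}) :
  (forall i, dominated (F i) (G i)) -> dominated (\prod_(i <- r) F i) (\prod_(i <- r) G i).
Proof.
move=> h; elim: r => [|a r IH]; last by rewrite !big_cons; apply: dominatedM.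
by rewrite !big_nil => i; rewrite !coef1; case: eqP => _; rewrite ?nrm1 ?nrm0.
Qed.

Lemma dominated_geom y (k N : nat) : nrm y = 1 ->
  dominated (\sum_(j < N.+1) (y ^+ j)%:P * 'X^(k * j)) (\sum_(j < N.+1) 'X^(k * j)).
Proof.
move=> y1 i; rewrite !coef_sum; apply: le_trans (nrm_sum _ _ _) _.
apply: ler_sum => j _; rewrite coefCM !coefXn nrmM nrmX y1 expr1n mul1r.
by case: eqP => _; rewrite ?nrm1 ?nrm0.
Qed.

Lemma coef_bound P (Q : {poly R}) (r : R) n : dominated P Q -> 0 <= r ->
  nrm P`_n * r ^+ n <= Q.[r].
Proof.
move=> h r0; have Q0 i : 0 <= Q`_i by apply: le_trans (nrm_ge0 _) (h i).
apply: (@le_trans _ _ (Q`_n * r ^+ n)); first by rewrite ler_wpM2r ?exprn_ge0.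
rewrite (@horner_coef_wide _ (maxn (size Q) n.+1)) ?leq_maxl//.
rewrite (bigD1 (Ordinal (leq_maxr (size Q) n.+1))) //= lerDl sumr_ge0// => i _.
by rewrite mulr_ge0 ?exprn_ge0.
Qed.

(** A Cauchy estimate: replacing signs and powers of [x] by their moduli gives a majorant with
    nonnegative coefficients, whose value at [r] is bounded independently of [N]. *)
Lemma crank_coef_bound x (r : R) : nrm x = 1 -> 0 < r < 1 ->
  exists2 B : R, 0 <= B & forall N n, nrm (crank_trunc x N)`_n * r ^+ n <= B.
Proof.
move=> x1 /andP[r0 r1]; pose c := (1 - r)^-1.
have c0 : 0 < c by rewrite invr_gt0 subr_gt0.
(* Each factor of the majorant at [r] is at most [expR ((1 + c + c) * r ^+ k)], and the powers of
   [r] sum to at most [c]. *)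
exists (expR ((1 + c + c) * c)); first exact: expR_ge0.
move=> N n.
pose D k : {poly R} := (1 + 'X^k) * (\sum_(j < N.+1) 'X^(k * j)) * (\sum_(j < N.+1) 'X^(k * j)).
have xV : nrm x^-1 = 1 by rewrite nrmV x1 invr1.
have dom : dominated (crank_trunc x N) (\prod_(1 <= k < N.+1) D k).
  apply: dominated_prod => k; apply: dominatedM; last exact: dominated_geom.
  apply: dominatedM; last exact: dominated_geom.
  move=> i; rewrite coefB coefD !coef1 !coefXn; apply: le_trans (nrmB _ _) _.
  by rewrite !nrm_nat.
apply: le_trans (coef_bound n dom (ltW r0)) _.
rewrite horner_prod big_add1 /= big_mkord.
have rk k : r ^+ k.+1 <= r by rewrite exprS ler_piMr ?(ltW r0)// exprn_ile1// ltW.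
have g k : (\sum_(j < N.+1) 'X^(k.+1 * j) : {poly R}).[r] <= expR (c * r ^+ k).
  rewrite horner_sum; under eq_bigr do rewrite hornerXn exprM.
  apply: le_trans (geometric_bound _ _) _.
    by rewrite exprn_ge0 ?ltW//= (le_lt_trans (rk k)).
  apply: le_trans (expR_ge1Dx _).
  have d0 : 0 < 1 - r ^+ k.+1 by rewrite subr_gt0 (le_lt_trans (rk k)).
  have -> : (1 - r ^+ k.+1)^-1 = 1 + (1 - r ^+ k.+1)^-1 * r ^+ k.+1.
    by field; rewrite lt0r_neq0.
  have r0' := ltW r0; have d0' := ltW d0.
  rewrite lerD2l; apply: ler_pM; rewrite ?invr_ge0 ?exprn_ge0//.
    by rewrite /c lef_pV2 ?posrE ?subr_gt0// ?(le_lt_trans (rk k))// lerD2l lerN2.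
  by rewrite exprS ler_piMl ?exprn_ge0// ltW.
apply: (@le_trans _ _ (\prod_(k < N) expR ((1 + c + c) * r ^+ k))); last first.
  rewrite -expR_sum ler_expR -mulr_sumr ler_pM2l ?addr_gt0//.
  by apply: geometric_bound; rewrite r1 ltW.
apply: ler_prod => k _.
have X0 : 0 <= (\sum_(j < N.+1) 'X^(k.+1 * j) : {poly R}).[r].
  by rewrite horner_sum sumr_ge0// => j _; rewrite hornerXn exprn_ge0// ltW.
have H0 : 0 <= (1 + 'X^(k.+1) : {poly R}).[r].
  by rewrite hornerD hornerXn hornerC addr_ge0// exprn_ge0// ltW.
rewrite /D !hornerM !mulr_ge0//= !mulrDl !expRD mul1r.
do 2 (apply: ler_pM; rewrite ?mulr_ge0//).
rewrite hornerD hornerXn hornerC; apply: le_trans (expR_ge1Dx _).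
by rewrite lerD2l exprS ler_piMl ?exprn_ge0 ?ltW.
Qed.

Lemma ccvg_expr y : nrm y < 1 -> ccvg (fun n => y ^+ n) 0.
Proof.
move=> y1; apply/ccvg_nrm; under eq_fun do rewrite subr0 nrmX.
by apply: cvg_expr; rewrite ger0_norm ?nrm_ge0.
Qed.

Lemma ccvg_unshift (u : nat -> C) l : ccvg (fun n => u n.+1) l -> ccvg u l.
Proof.
move=> /ccvgP h; apply/ccvgP => e /h [N hN]; exists N.+1 => -[//|n] Nn; exact: hN.
Qed.

Section Eval.
Variables (x q : C).
Hypotheses (x1 : nrm x = 1) (q1 : nrm q < 1).

Let rbound k : nrm (x * q ^+ k.+1) < 1.
Proof. by rewrite nrmM x1 mul1r nrmX exprn_ilt1 ?nrm_ge0. Qed.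

Lemma geom_denom_neq0 k : 1 - x * q ^+ k.+1 != 0.
Proof.
rewrite subr_eq0 eq_sym; apply/negP => /eqP h; have := rbound k; by rewrite h nrm1 ltxx.
Qed.

Lemma geom_horner k N :
  (\sum_(j < N.+1) (x ^+ j)%:P * 'X^(k.+1 * j)).[q] =
  (1 - (x * q ^+ k.+1) ^+ N.+1) / (1 - x * q ^+ k.+1).
Proof.
apply: (canRL (mulfK (geom_denom_neq0 k))).
rewrite horner_sum [LHS]mulrC -[RHS]opprB subrX1 -[RHS]mulNr opprB; congr (_ * _).
by apply: eq_bigr => j _; rewrite !hornerE exprMn exprM.
Qed.

(** These are the numerators left by truncating the geometric series in [crank_trunc]. *)
Lemma geom_corr_ccvg : ccvg (fun N => \prod_(k < N) (1 - (x * q ^+ k.+1) ^+ N.+1)) 1.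
Proof.
pose a N k : C := if (k < N)%N then - (x * q ^+ k.+1) ^+ N.+1 else 0.
apply: (@prod_dominated_ccvg R a (fun=> 0) (fun k => nrm q ^+ k) (1 - nrm q)^-1).
- move=> N k; rewrite /a; case: ltnP => _; last by rewrite nrm0 exprn_ge0 ?nrm_ge0.
  rewrite nrmN nrmX nrmM x1 mul1r nrmX -exprM.
  by apply: ler_wiXn2l; rewrite ?nrm_ge0 ?ltW//; nia.
- by apply: geometric_bound; rewrite nrm_ge0.
- move=> k; apply: (@ccvg_ev R (fun N => - (x * q ^+ k.+1) ^+ N.+1) _ _ k.+1).
    by move=> N kN; rewrite /a kN.
  rewrite -[X in ccvg _ X]oppr0; apply: ccvgN.
  exact: (ccvg_sub leqnSn (ccvg_expr (rbound k))).
- move=> N; apply: (@ccvg_ev R (fun=> \prod_(k < N) (1 - (x * q ^+ k.+1) ^+ N.+1)) _ _ N) (ccvg_cst _) => J NJ.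
  rewrite -(big_mkord xpredT (fun k => 1 + a N k)) [RHS](big_cat_nat (leq0n N) NJ) /=.
  rewrite [X in _ * X]big_nat_cond [X in _ * X]big1 ?mulr1.
    by rewrite big_mkord; apply: eq_bigr => k _; rewrite /a ltn_ord.
  by move=> i /andP[/andP[Ni _] _]; rewrite /a ltnNge Ni addr0.
- apply: ccvg_ext (ccvg_cst 1) => J; rewrite big1// => k _; exact: addr0.
Qed.
End Eval.

(** The values of [crank_trunc x N] at [q] tend to the infinite product, but its coefficients above
    degree [N] are not those of the series. As [crank_coef_bound] is uniform in [N], they contribute
    only a geometric tail. *)
Lemma crank_series x q : nrm x = 1 -> nrm q < 1 ->
  ccvg (fun N => \sum_(n < N) crank_coef x n%:Z * q ^+ n)
    (Ep 1 q / (Ep x q * Ep x^-1 q)).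
Proof.
move=> x1 q1; have xV : nrm x^-1 = 1 by rewrite nrmV x1 invr1.
have D1 := geom_denom_neq0 x1 q1; have D2 := geom_denom_neq0 xV q1.
have lim1 : ccvg (fun N => (crank_trunc x N).[q]) (Ep 1 q / (Ep x q * Ep x^-1 q)).
  have E1 := Ep_neq0 q1 D1; have E2 := Ep_neq0 q1 D2.
  have h := ccvgM (ccvgM (Ep_ccvg q1 1) (ccvgV (mulf_neq0 E1 E2) (ccvgM (Ep_ccvg q1 x) (Ep_ccvg q1 x^-1))))
     (ccvgM (geom_corr_ccvg x1 q1) (geom_corr_ccvg xV q1)).
  rewrite !mulr1 in h; apply: ccvg_ext h => N; rewrite /crank_trunc horner_prod big_add1 /= big_mkord.
  rewrite -!big_split /= -prodfV -!big_split /=; apply: eq_bigr => k _ /=.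
  rewrite !hornerM !geom_horner// !hornerE /=.
  move: (D1 k) (D2 k) (1 - q ^+ _) ((_ * _) ^+ N.+1) ((_ * _) ^+ N.+1) => {}D1 {}D2 u v w.
  move: (1 - _) (1 - _) D1 D2 => e f e0 f0.
  by field; rewrite e0 f0.
(* Any radius strictly between [nrm q] and 1 serves. *)
pose r := (nrm q + 1) / 2.
have r01 : 0 < r < 1 by have := nrm_ge0 q; rewrite /r; lra.
have [r0 r1] := andP r01.
have [B B0 hB] := crank_coef_bound x1 r01.
pose z := nrm q / r.
have z0 : 0 <= z by rewrite divr_ge0 ?nrm_ge0 ?ltW.
have z1 : z < 1 by rewrite ltr_pdivrMr// mul1r /r; lra.
have tail N : nrm (\sum_(n < N.+1) crank_coef x n%:Z * q ^+ n - (crank_trunc x N).[q]) <=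
    B * (1 - z)^-1 * z ^+ N.+1.
  set P := crank_trunc x N.
  rewrite (@horner_coef_wide _ (N.+1 + size P)) ?leq_addl// big_split_ord /= opprD addrA.
  rewrite [X in nrm (X - _)](_ : _ = 0) ?sub0r ?nrmN; last first.
    apply/eqP; rewrite subr_eq0; apply/eqP; apply: eq_bigr => n _.
    have nN : (n <= N)%N by rewrite -ltnS.
    by rewrite /= /P (crank_trunc_coef _ nN).
  apply: le_trans (nrm_sum _ _ _) _.
  apply: (@le_trans _ _ (\sum_(i < size P) B * z ^+ N.+1 * z ^+ i)).
    apply: ler_sum => i _; rewrite nrmM nrmX -mulrA -exprD /z expr_div_n.
    rewrite mulrA ler_pdivlMr ?exprn_gt0// mulrAC ler_wpM2r ?exprn_ge0 ?nrm_ge0//.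
    exact: hB.
  rewrite -mulr_sumr mulrAC ler_wpM2r ?exprn_ge0//.
  by rewrite ler_wpM2l// geometric_bound// z0.
apply: ccvg_unshift; rewrite -[X in ccvg _ X]addr0.
have diff : ccvg (fun N => \sum_(n < N.+1) crank_coef x n%:Z * q ^+ n - (crank_trunc x N).[q]) 0.
  apply/ccvg_nrm; under eq_fun do rewrite subr0.
  have hz : ((fun N => B * (1 - z)^-1 * z ^+ N.+1) @ \oo --> (0 : R))%classic.
    rewrite -(mulr0 (B * (1 - z)^-1)); apply: cvgM; first exact: cvg_cst.
    rewrite (cvg_shiftS (fun n => z ^+ n)); apply: cvg_expr; by rewrite ger0_norm.
  apply: (squeeze_cvgr _ (cvg_cst 0) hz).
  by apply: nearW => N; rewrite nrm_ge0 tail.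
by apply: ccvg_ext (ccvgD lim1 diff) => N; rewrite addrC subrK.
Qed.

End CrankSeries.

(** The Euclidean algorithm on the bottom row. The third hypothesis multiplies on the right by the
    matrix of [t |-> - 1 / (t + q)]; the first two cover the matrices with [c = 0]. *)
Lemma SL2_ind (P : int -> int -> int -> int -> Prop) :
  (forall b, P 1 b 0 1) -> (forall b, P (-1) b 0 (-1)) ->
  (forall a b c d q : int, a * d - b * c = 1 -> P a b c d ->
     P (- b) (a - b * q) (- d) (c - d * q)) ->
  forall a b c d : int, a * d - b * c = 1 -> P a b c d.
Proof.
move=> P1 PN1 PS a b c d; have [n] := ubnP `|c|%N.
elim: n => // n IH in a b c d *; rewrite ltnS => cn det.
have [c0|c0] := eqVneq c 0.
  rewrite c0 mulr0 subr0 in det *.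
  have [[-> ->]|[-> ->]] : (a = 1 /\ d = 1) \/ (a = -1 /\ d = -1).
    have /eqP := congr1 absz det; rewrite abszM muln_eq1 => /andP[/eqP ha /eqP hd]; nia.
    exact: P1.
  exact: PN1.
pose q := (d %/ c)%Z.
have dE : d = q * c + (d %% c)%Z by exact: divz_eq.
have m0 : (0 <= d %% c)%Z by exact: modz_ge0.
have m1 : (d %% c < `|c|)%Z by exact: ltz_mod.
have cE : d - c * q = (d %% c)%Z by rewrite {1}dE; ring.
(* Undo one step: the predecessor has lower left entry [d mod c]. *)
have := PS (b - a * q) (- a) (d - c * q) (- c) q.
have -> : - - a = a by ring.
have -> : b - a * q - - a * q = b by ring.
have -> : - - c = c by ring.
have -> : d - c * q - - c * q = d by ring.
apply; first by rewrite -det; ring.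
apply: IH; last by rewrite -det; ring.
rewrite cE; apply: leq_trans cn; lia.
Qed.

(** * Klein forms under SL_2(Z) *)

Section Klein.
Variable R : realType.
Local Notation C := R[i].
Implicit Types (u v w x y z q t : C).

Implicit Types (r s : R).

Lemma phi_def u t : phi u t =
  sn u * (Ep (ce u) (ce t) * Ep (ce (- u)) (ce t) / Ep 1 (ce t) ^+ 2).
Proof. by []. Qed.

Local Opaque ce sn Ep phi.

Definition mob (a b c d : int) t : C := (a%:~R * t + b%:~R) / (c%:~R * t + d%:~R).

Lemma Im_intM (a : int) t : complex.Im (a%:~R * t) = a%:~R * complex.Im t.
Proof. by rewrite -(rmorph_int (real_complex R)) Im_realM. Qed.

Lemma Im_int (a : int) : complex.Im (a%:~R : C) = 0.
Proof. by rewrite -(rmorph_int (real_complex R)). Qed.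

Lemma cocycle_neq0 (a b c d : int) t : a * d - b * c = 1 -> 0 < complex.Im t ->
  c%:~R * t + d%:~R != 0.
Proof.
move=> det t0; apply/eqP => h.
have /eqP := congr1 (@complex.Im R) h; rewrite cImD Im_intM Im_int addr0 /= mulf_eq0.
rewrite (gt_eqF t0) orbF intr_eq0 => /eqP c0; move: h; rewrite c0 mul0r add0r.
move=> /eqP; rewrite intr_eq0 => /eqP d0; move: det; rewrite c0 d0 !mulr0; lia.
Qed.

Lemma Im_mob (a b c d : int) t : a * d - b * c = 1 -> 0 < complex.Im t ->
  0 < complex.Im (mob a b c d t).
Proof.
move=> det t0; have := cocycle_neq0 det t0; rewrite /mob.
rewrite -!(rmorph_int (real_complex R)); have {}det : (a%:~R * d%:~R - b%:~R * c%:~R = 1 :> R).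
  by rewrite -!intrM -intrB det.
move: (a%:~R : R) (b%:~R : R) (c%:~R : R) (d%:~R : R) det => {a b c d} a b c d det.
case: t t0 => x y /= y0; rewrite !mul0r !subr0 !addr0 => nz.
have n0 : 0 < (c * x + d) ^+ 2 + (c * y) ^+ 2.
  rewrite lt_def addr_ge0 ?sqr_ge0// andbT paddr_eq0 ?sqr_ge0// !sqrf_eq0.
  apply: contra nz => /andP[/eqP h1 /eqP h2]; apply/eqP.
  by apply/eqP; rewrite eq_complex /= !mul0r ?subr0 ?addr0 h1 h2 !eqxx.
rewrite (_ : _ + _ = (a * d - b * c) * y / ((c * x + d) ^+ 2 + (c * y) ^+ 2)).
  by rewrite det mul1r divr_gt0.
by field; exact: lt0r_neq0.
Qed.

Lemma mob_ST (a b c d q : int) t : t + q%:~R != 0 ->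
  mob a b c d (- (t + q%:~R)^-1) = mob (- b) (a - b * q) (- d) (c - d * q) t /\
  c%:~R * - (t + q%:~R)^-1 + d%:~R =
    - ((- d)%:~R * t + (c - d * q)%:~R) / (t + q%:~R).
Proof.
move=> tn.
have aux x y z : z != 0 -> - x / z / (- y / z) = x / y.
  by move=> z0; rewrite [- x / z]mulNr [- y / z]mulNr invrN mulrNN [(y / z)^-1]invfM invrK mulrACA mulVf// mulr1.
have numE (m n : int) : m%:~R * - (t + q%:~R)^-1 + n%:~R =
    - ((- n)%:~R * t + (m - n * q)%:~R) / (t + q%:~R).
  by rewrite mulrNz intrB intrM; field.
by split=> //; rewrite /mob !numE aux.
Qed.

(* The Klein form with characteristic [(r1, r2)], up to a constant. *)
Definition kl r1 r2 t : C :=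
  ce (r1%:C * (r1%:C * t + r2%:C) / 2) * phi (r1%:C * t + r2%:C) t.

Lemma phi_Tint u t (n : int) : phi u (t + n%:~R) = phi u t.
Proof. by rewrite !phi_def ceDint. Qed.

Lemma kl_T r1 r2 t (n : int) : kl r1 r2 (t + n%:~R) = kl r1 (r2 + r1 * n%:~R) t.
Proof.
rewrite /kl phi_Tint.
have -> : r1%:C * (t + n%:~R) + r2%:C = r1%:C * t + (r2 + r1 * n%:~R)%:C.
  by rewrite rmorphD rmorphM rmorph_int /=; ring.
by [].
Qed.

Lemma kl_N r1 r2 t : kl (- r1) (- r2) t = - kl r1 r2 t.
Proof.
rewrite /kl.
have -> : (- r1)%:C * t + (- r2)%:C = - (r1%:C * t + r2%:C).
  by rewrite !rmorphN /=; ring.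
by rewrite phiN mulrN rmorphN /= mulrNN.
Qed.

(** The prefactor of [kl] is designed to absorb the Gaussian of [phi_inv], so that no multiplier is
    left. *)
Lemma kl_S r1 r2 t : 0 < complex.Im t -> t * kl r1 r2 (- t^-1) = kl r2 (- r1) t.
Proof.
move=> t0; have tn0 : t != 0 by apply: contraTneq t0 => ->; rewrite /= ltxx.
rewrite /kl; set u := r2%:C * t + (- r1)%:C.
have uE : r1%:C * - t^-1 + r2%:C = u / t.
  by rewrite /u rmorphN /=; field.
have aux (x y z e f : C) : t * y = e * z -> x * e = f -> t * (x * y) = f * z.
  by move=> h <-; rewrite mulrCA h mulrA.
rewrite uE; apply: aux (phi_inv u t0) _; rewrite -ceD; congr ce.
by rewrite /u rmorphN /=; field.
Qed.

Local Opaque kl.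

(** Weight -1 and no multiplier: the matrix acts on the row of characteristics from the right. Roots
    of unity arise only later, when characteristics are reduced by integers. *)
Lemma kl_SL2 (a b c d : int) r1 r2 t : a * d - b * c = 1 -> 0 < complex.Im t ->
  (c%:~R * t + d%:~R) * kl r1 r2 (mob a b c d t) =
  kl (r1 * a%:~R + r2 * c%:~R) (r1 * b%:~R + r2 * d%:~R) t.
Proof.
move: a b c d r1 r2 t.
(* The point is quantified inside the induction, because the hypothesis is used at
   [- 1 / (t + q)]. *)
suff H a b c d : a * d - b * c = 1 -> forall r1 r2 t, 0 < complex.Im t ->
    (c%:~R * t + d%:~R) * kl r1 r2 (mob a b c d t) =
    kl (r1 * a%:~R + r2 * c%:~R) (r1 * b%:~R + r2 * d%:~R) t.
  by move=> a b c d r1 r2 t /H; apply.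
move: a b c d; apply: SL2_ind => [b|b|a b c d q det IH] r1 r2 t t0.
- have -> : mob 1 b 0 1 t = t + b%:~R by rewrite /mob mul0r add0r mul1r divr1.
  have -> : 0%:~R * t + 1%:~R = 1 :> C by rewrite mul0r add0r.
  have -> : r1 * 1%:~R + r2 * 0%:~R = r1 by rewrite mulr1 mulr0 addr0.
  have -> : r1 * b%:~R + r2 * 1%:~R = r2 + r1 * b%:~R by rewrite mulr1 addrC.
  by rewrite mul1r kl_T.
- have -> : mob (-1) b 0 (-1) t = t + (- b)%:~R.
    by rewrite /mob !mulrNz; field.
  have -> : 0%:~R * t + (-1)%:~R = -1 :> C by rewrite mul0r add0r.
  have -> : r1 * (-1)%:~R + r2 * 0%:~R = - r1 by rewrite mulr0 addr0 mulrN mulr1.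
  have -> : r1 * b%:~R + r2 * (-1)%:~R = - (r2 + r1 * (- b)%:~R).
    by rewrite !mulrNz; ring.
  by rewrite mulN1r kl_T kl_N.
have t1 : 0 < complex.Im (t + q%:~R) by rewrite cImD Im_int addr0.
have tn : t + q%:~R != 0 by apply: contraTneq t1 => ->; rewrite /= ltxx.
have [mobE numE] := mob_ST a b c d tn.
have := IH r1 r2 _ (Im_invN t1); rewrite mobE numE => IH'.
have := kl_S (r1 * a%:~R + r2 * c%:~R) (r1 * b%:~R + r2 * d%:~R) t1.
rewrite -IH' kl_T => h.
have -> : r1 * (- b)%:~R + r2 * (- d)%:~R = - (r1 * b%:~R + r2 * d%:~R).
  by rewrite !mulrNz; ring.
have -> : r1 * (a - b * q)%:~R + r2 * (c - d * q)%:~R =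
   - (- (r1 * a%:~R + r2 * c%:~R) + (r1 * b%:~R + r2 * d%:~R) * q%:~R).
  by rewrite !intrB !intrM; ring.
rewrite kl_N -h; move: (kl _ _ _) => K; move: tn; set y := t + q%:~R => tn.
by rewrite mulNr mulNr mulrN opprK [_ / y]mulrC -mulrA mulrA divff// mul1r.
Qed.

End Klein.

(** * The discriminant from the 2-torsion points *)

Section Delta.
Variable R : realType.
Local Notation C := R[i].
Implicit Types (u v w x y z q t : C) (r s : R).

Local Opaque ce sn Ep phi.

Lemma kl_nat (l : nat) r t : 0 < complex.Im t ->
  kl l%:R r t = (-1) ^+ l * ce (- (l%:R * r%:C / 2)) * phi r%:C t.
Proof.
move=> t0; rewrite /kl (rmorph_nat (real_complex R)) addrC phiDtn//.
have aux (a b c d e : C) : a * c = d -> a * (b * c * e) = b * d * e.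
  by move=> <-; ring.
by apply: aux; rewrite -ceD; congr ce; field.
Qed.

(** Euler's identity: the last two products combine to the factors [1 - q^(2m-1)]. After
    multiplication by [Ep 1 q], the first [n] factors of everything are the first [2n] factors of
    [Ep 1 q]. *)
Lemma euler_odd q : nrm q < 1 -> forall y, y ^+ 2 = q -> y != 0 ->
  Ep (-1) q * (Ep y^-1 q * Ep (- y^-1) q) = 1.
Proof.
move=> q1 y yq y0; apply: (mulfI (Ep1_neq0 q1)); rewrite mulr1.
have h := ccvgM (Ep_ccvg q1 1) (ccvgM (Ep_ccvg q1 (-1)) (ccvgM (Ep_ccvg q1 y^-1) (Ep_ccvg q1 (- y^-1)))).
apply: ccvg_unique h _.
have hd n : (n <= n.*2)%N by lia.
apply: ccvg_ext (ccvg_sub hd (Ep_ccvg q1 1)) => n; rewrite -!big_split /=.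
elim: n => [|n IH]; first by rewrite !big_ord0.
rewrite doubleS !big_ord_recr /= IH -mulrA; congr (_ * _).
have q0 : q != 0 by rewrite -yq expf_neq0.
have e1 : q ^+ n.*2.+2 = q ^+ n.+1 * q ^+ n.+1 by rewrite -exprD; congr (_ ^+ _); lia.
have e2 : q ^+ n.*2.+1 = (y^-1 * q ^+ n.+1) * (y^-1 * q ^+ n.+1).
  by apply: (mulfI q0); rewrite -exprS e1 [in RHS]mulrACA -invfM -[y * y]expr2 yq mulVKf.
rewrite e1 e2 mulNr; ring.
Qed.

Definition Delta t : C := ce t * Ep 1 (ce t) ^+ 24.

(* A constant times [eta^-6], as [theta_2 theta_3 theta_4 = 2 eta^3]. *)
Definition klhalf t : C := kl 0 2^-1 t * kl 2^-1 0 t * kl 2^-1 2^-1 t.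

(** The numerators at the three points are squares of [Ep] at [-1], [y^-1] and [- y^-1], which
    cancel by [euler_odd]; the denominators survive. *)
Lemma klhalfE t : 0 < complex.Im t ->
  klhalf t = sn 2^-1 * (ce (- (t / 8)) * ce (- ((t + 1) / 8))) / Ep 1 (ce t) ^+ 6.
Proof.
move=> t0; have q1 := nrm_ce_lt1 t0; have E0 := Ep1_neq0 q1.
set y := ce (t / 2); have y0 : y != 0 by apply: ce_neq0.
have yq : y ^+ 2 = ce t by rewrite /y -ceMn; congr ce; field.
have yV : y^-1 = ce (- (t / 2)) by rewrite ceN.
have W := euler_odd q1 yq y0.
have ceN12 : ce (- 2^-1 : C) = -1 by rewrite ceN ce_half invrN invr1.
have k1 : kl 0 2^-1 t = sn 2^-1 * (Ep (-1) (ce t) ^+ 2 / Ep 1 (ce t) ^+ 2).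
  by rewrite /kl real_complex_half !mul0r ce0 mul1r add0r phi_def ce_half ceN12 expr2.
have k2 : kl 2^-1 0 t = - ce (- (t / 8)) * (Ep y^-1 (ce t) ^+ 2 / Ep 1 (ce t) ^+ 2).
  rewrite /kl real_complex_half !addr0.
  have -> : 2^-1 * t = t / 2 by rewrite mulrC.
  have sh := Ep_shift q1 y^-1; rewrite -yq expr2 mulKf// -expr2 yq in sh.
  rewrite phi_def snE -yV -/y -sh.
  have -> : ce (- (t / 8)) = ce (2^-1 * (t / 2) / 2) * ce (- (t / 2 / 2)).
    by rewrite -ceD; congr ce; field.
  by ring.
have k3 : kl 2^-1 2^-1 t = - ce (- ((t + 1) / 8)) * (Ep (- y^-1) (ce t) ^+ 2 / Ep 1 (ce t) ^+ 2).
  rewrite /kl real_complex_half.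
  have -> : 2^-1 * t + 2^-1 = (t + 1) / 2 by rewrite mulrDl mul1r mulrC.
  have c1 : ce ((t + 1) / 2) = - y by rewrite mulrDl mul1r ceD ce_half mulrN1.
  have c2 : ce (- ((t + 1) / 2)) = - y^-1 by rewrite ceN c1 invrN.
  have sh := Ep_shift q1 (- y^-1); rewrite -yq expr2 mulNr mulKf// -expr2 yq in sh.
  rewrite phi_def snE c1 c2 -sh.
  have -> : ce (- ((t + 1) / 8)) = ce (2^-1 * ((t + 1) / 2) / 2) * ce (- ((t + 1) / 2 / 2)).
    by rewrite -ceD; congr ce; field.
  by ring.
rewrite /klhalf k1 k2 k3.
have aux (s e1 e2 A B D E : C) : E != 0 -> A * (B * D) = 1 ->
    s * (A ^+ 2 / E ^+ 2) * (- e1 * (B ^+ 2 / E ^+ 2)) * (- e2 * (D ^+ 2 / E ^+ 2)) =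
    s * (e1 * e2) / E ^+ 6.
  move=> En0 h; rewrite (_ : _ * _ * _ = s * (e1 * e2) / E ^+ 6 * (A * (B * D)) ^+ 2).
    by rewrite h expr1n mulr1.
  by field.
exact: aux.
Qed.

Lemma kl_def r1 r2 t : kl r1 r2 t =
  ce (r1%:C * (r1%:C * t + r2%:C) / 2) * phi (r1%:C * t + r2%:C) t.
Proof. by []. Qed.

Lemma klhalf_Delta t : 0 < complex.Im t ->
  klhalf t ^+ 4 * Delta t = (sn (2^-1 : C) * ce (- (8^-1 : C))) ^+ 4.
Proof.
move=> t0; rewrite klhalfE// /Delta; have E0 := Ep1_neq0 (nrm_ce_lt1 t0).
have aux (E a b c s e : C) : E != 0 -> e = a ^+ 8 -> a * b = 1 ->
    (s * (b * (b * c)) / E ^+ 6) ^+ 4 * (e * E ^+ 24) = (s * c) ^+ 4.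
  move=> En0 -> ab; rewrite expr_div_n -exprM -[(6 * 4)%N]/24%N (mulrC (a ^+ 8)) [LHS]mulrA.
  rewrite divfK ?expf_neq0//.
  rewrite (_ : _ * _ = (s * c) ^+ 4 * (a * b) ^+ 8); last by ring.
  by rewrite ab expr1n mulr1.
have -> : ce (- ((t + 1) / 8)) = ce (- (t / 8)) * ce (- (8^-1)).
  by rewrite -ceD; congr ce; field.
apply: aux => //; last exact: ce_mulN.
by rewrite -ceMn; congr ce; field.
Qed.

Local Opaque kl.

(** Inversion permutes the three 2-torsion points up to signs and a fourth root of unity, which the
    fourth power removes. *)
Lemma klhalf_S t : 0 < complex.Im t -> t ^+ 12 * klhalf (- t^-1) ^+ 4 = klhalf t ^+ 4.
Proof.
move=> t0.
have h1 := kl_S 0 2^-1 t0; have h2 := kl_S 2^-1 0 t0; have h3 := kl_S 2^-1 2^-1 t0.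
have h4 := kl_N 0 2^-1 t; rewrite oppr0 in h4.
have h5 : kl 2^-1 (- 2^-1) t = - ce (- 4^-1) * kl 2^-1 2^-1 t.
  rewrite !kl_def rmorphN /= real_complex_half.
  have -> : 2^-1 * t - 2^-1 = (2^-1 * t + 2^-1) + (-1)%:~R by rewrite mulrNz; field.
  rewrite phiDint.
  have -> : ce (2^-1 * (2^-1 * t + 2^-1 + (-1)%:~R) / 2) =
      ce (- (4^-1)) * ce (2^-1 * (2^-1 * t + 2^-1) / 2).
    by rewrite -ceD; congr ce; rewrite mulrNz; field.
  rewrite (_ : (-1 : C) ^ (-1) = -1); last by rewrite exprN1 invrN1.
  by ring.
rewrite h4 in h2; rewrite h5 in h3; rewrite oppr0 in h1.
have c4 : ce (- (4^-1 : C)) ^+ 4 = 1.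
  rewrite -ceMn (_ : 4 * - 4^-1 = (-1)%:~R); first exact: ce_int.
  by rewrite mulrNz; field.
have aux (a b c a' b' c' e : C) : t * a = b' -> t * b = - a' -> t * c = - e * c' ->
   e ^+ 4 = 1 -> t ^+ 12 * (a * b * c) ^+ 4 = (a' * b' * c') ^+ 4.
  move=> ta tb tc e4.
  rewrite (_ : _ * _ = ((t * a) * (t * b) * (t * c)) ^+ 4); last by ring.
  by rewrite ta tb tc; ring: e4.
exact: aux h1 h2 h3 c4.
Qed.

Lemma Delta_S t : 0 < complex.Im t -> Delta (- t^-1) = t ^+ 12 * Delta t.
Proof.
move=> t0; have D1 := klhalf_Delta t0; have D2 := klhalf_Delta (Im_invN t0).
have S := klhalf_S t0.
have k0 : klhalf t ^+ 4 != 0.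
  have : (sn (2^-1 : C) * ce (- (8^-1 : C))) ^+ 4 != 0.
    rewrite expf_neq0// mulf_neq0 ?ce_neq0//; apply/eqP => /sn_eq0 [n hn].
    have /eqP : (2 * n)%:~R = 1%:~R :> C by rewrite intrM -hn divff.
    by rewrite eqr_int => /eqP; lia.
  by rewrite -D1 mulf_eq0 negb_or => /andP[].
have aux (k k' D D' K s : C) : k != 0 -> k * D = K -> k' * D' = K -> s * k' = k -> D' = s * D.
  move=> kn0 h h' hs; apply: (mulfI kn0).
  by rewrite mulrCA h -h' mulrA hs.
exact: aux k0 D1 D2 S.
Qed.

Lemma Delta_T t (n : int) : Delta (t + n%:~R) = Delta t.
Proof. by rewrite /Delta ceDint. Qed.

Lemma Delta_def t : Delta t = ce t * Ep 1 (ce t) ^+ 24.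
Proof. by []. Qed.

Local Opaque Delta.

Lemma Delta_SL2 (a b c d : int) t : a * d - b * c = 1 -> 0 < complex.Im t ->
  Delta (mob a b c d t) = (c%:~R * t + d%:~R) ^+ 12 * Delta t.
Proof.
move=> det; move: t; move: a b c d det.
apply: SL2_ind => [b|b|a b c d q det IH] t t0.
- have -> : mob 1 b 0 1 t = t + b%:~R by rewrite /mob mul0r add0r mul1r divr1.
  by rewrite Delta_T mul0r add0r expr1n mul1r.
- have -> : mob (-1) b 0 (-1) t = t + (- b)%:~R by rewrite /mob !mulrNz; field.
  by rewrite Delta_T mul0r add0r mulrNz -[12%N]/(2 * 6)%N exprM sqrrN expr1n expr1n mul1r.
have t1 : 0 < complex.Im (t + q%:~R) by rewrite cImD Im_int addr0.
have tn : t + q%:~R != 0 by apply: contraTneq t1 => ->; rewrite /= ltxx.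
have [mobE numE] := mob_ST a b c d tn.
have e1 := IH _ (Im_invN t1).
have e2 := Delta_S t1; rewrite Delta_T in e2.
have aux (D D1 D2 x y s : C) : s != 0 -> x = - y / s -> D = x ^+ 12 * D2 -> D2 = s ^+ 12 * D1 ->
   D = y ^+ 12 * D1.
  by move=> s0 -> -> ->; field.
rewrite -mobE; exact: aux tn numE e1 e2.
Qed.

End Delta.

(** * Level p: torsion products and the quotient eta(p^2 t) / eta(t) *)

Section LevelP.
Variable R : realType.
Local Notation C := R[i].
Implicit Types (u v w x y z q t : C) (r : R).

Local Opaque ce sn Ep phi kl Delta.

Variables p M s : nat.
Hypothesis pM : p = M.*2.+1.
Hypothesis ps : (p * p = 24 * s + 1)%N.

Let p0 : (p%:R : C) != 0.
Proof. by rewrite pnatr_eq0 pM. Qed.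

Let Ms : (M * M.+1 = 6 * s)%N.
Proof. by move: ps; rewrite pM; nia. Qed.

Definition cprod (d : nat) : C := \prod_(k < M) sn (k.+1%:R * d%:R / p%:R).

Definition Pi (d : nat) t : C := \prod_(k < M) phi (k.+1%:R * d%:R / p%:R) t.

Lemma prim_ced d : coprime d p -> M.*2.+1.-primitive_root (ce (d%:R / p%:R : C)).
Proof.
move=> dp; rewrite ceMn -pM prim_root_exp_coprime//; apply: prim_ce; by rewrite pM.
Qed.

(** The square does not depend on [d], so [cprod d] is [cprod 1] up to a sign, as in Gauss's lemma;
    the sign is never determined. *)
Lemma cprod_sqr d : coprime d p -> cprod d ^+ 2 = (-1) ^+ M * p%:R.
Proof.
move=> dp; have h := prod_unity_pair1 (prim_ced dp).
rewrite [in RHS]pM -h /cprod -prodrXl -[in (-1) ^+ M](card_ord M) -prodr_const -big_split /=.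
apply: eq_bigr => k _.
rewrite mulN1r -ceMn -ceN mulrA -sn_sqrN opprK //.
Qed.

Lemma cprod_neq0 d : coprime d p -> cprod d != 0.
Proof.
move=> dp; have := cprod_sqr dp; apply: contra_eq_neq => ->.
by rewrite expr0n /= eq_sym mulf_neq0// signr_eq0.
Qed.

Lemma Ep_prod d t : coprime d p -> 0 < complex.Im t ->
  Ep 1 (ce t) * \prod_(k < M) (Ep (ce (k.+1%:R * d%:R / p%:R)) (ce t) *
     Ep (ce (- (k.+1%:R * d%:R / p%:R))) (ce t)) = Ep 1 (ce (p%:R * t)).
Proof.
move=> dp t0; have q1 := nrm_ce_lt1 t0.
have t0' : 0 < complex.Im (p%:R * t).
  by rewrite -(rmorph_nat (real_complex R)) Im_realM mulr_gt0// ltr0n pM.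
have h1 := @ccvg_prod R M (fun k N => \prod_(m < N) (1 - ce (k.+1%:R * d%:R / p%:R) * ce t ^+ m.+1) *
  \prod_(m < N) (1 - ce (- (k.+1%:R * d%:R / p%:R)) * ce t ^+ m.+1)) _
  (fun k => ccvgM (Ep_ccvg q1 _) (Ep_ccvg q1 _)).
apply: ccvg_unique (ccvgM (Ep_ccvg q1 1) h1) _.
apply: ccvg_ext (Ep_ccvg (nrm_ce_lt1 t0') 1) => N.
rewrite [X in _ = _ * X](eq_bigr (fun k : 'I_M => \prod_(m < N)
  ((1 - ce (k.+1%:R * d%:R / p%:R) * ce t ^+ m.+1) *
   (1 - ce (- (k.+1%:R * d%:R / p%:R)) * ce t ^+ m.+1)))); last first.
  by move=> k _; rewrite big_split.
rewrite exchange_big -big_split /=; apply: eq_bigr => m _.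
have h := prod_unity_pair (ce t ^+ m.+1) (prim_ced dp).
rewrite !mul1r ceMn -exprM mulnC exprM pM -h; congr (_ * _); apply: eq_bigr => k _.
by rewrite -[ce (d%:R / _) ^+ _]ceMn -ceN !mulrA -pM.
Qed.

(** Up to the constant this is eta(p t) / eta(t)^p, in which the fractional powers of [q] cancel. *)
Lemma PiE d t : coprime d p -> 0 < complex.Im t ->
  Pi d t = cprod d * (Ep 1 (ce (p%:R * t)) / Ep 1 (ce t) ^+ p).
Proof.
move=> dp t0; rewrite -(Ep_prod dp t0) /Pi /cprod.
under eq_bigr do rewrite phi_def.
rewrite big_split big_split /=; congr (_ * _).
have E0 := Ep1_neq0 (nrm_ce_lt1 t0).
have EpM (E : C) : E ^+ p = E * (E ^+ 2) ^+ M by rewrite pM exprS -muln2 mulnC exprM.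
rewrite prodr_const card_ord exprVn EpM.
have aux (E Y X : C) : E != 0 -> X / Y = E * X / (E * Y).
  by move=> En0; rewrite -mulf_div divff// mul1r.
exact: aux.
Qed.

Lemma sum_triangle : (\sum_(k < M) k.+1 = 3 * s)%N.
Proof.
have h n : (2 * \sum_(k < n) k.+1 = n * n.+1)%N.
  by elim: n => [|n IH]; rewrite ?big_ord0// big_ord_recr /= mulnDr IH; lia.
by have := h M; rewrite Ms; lia.
Qed.

Lemma sum_squares : (\sum_(k < M) k.+1 * k.+1 = p * s)%N.
Proof.
have h n : (6 * \sum_(k < n) k.+1 * k.+1 = n * n.+1 * n.*2.+1)%N.
  by elim: n => [|n IH]; rewrite ?big_ord0// big_ord_recr /= mulnDr IH; nia.
by have := h M; rewrite Ms -pM; nia.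
Qed.

(** By [sum_triangle] and [sum_squares] the exponents add up to [g s (3 - d) / 2], an integer
    because [d] is odd. *)
Lemma multiplier_eq1 (g d : nat) : odd d ->
  \prod_(k < M) ((-1) ^+ (k.+1 * g) * ce (- ((k.+1 * g)%:R * (k.+1%:R * d%:R / p%:R) / 2))) = 1 :> C.
Proof.
move=> od.
have term (k : nat) : (-1) ^+ (k * g) * ce (- ((k * g)%:R * (k%:R * d%:R / p%:R) / 2)) =
   ce (g%:R / 2 * k%:R - (g%:R * d%:R / (2 * p%:R)) * (k * k)%:R) :> C.
  by rewrite -ce_half -ceMn -ceD; congr ce; rewrite !natrM; field.
under eq_bigr do rewrite term.
rewrite -(big_morph _ (@ceD R) (ce0 R)) big_split sumrN /= -!mulr_sumr -!natr_sum.
rewrite sum_triangle sum_squares.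
have -> : d = (d./2 * 2 + 1)%N by lia.
rewrite (_ : _ - _ = (g%:Z * s%:Z * (1 - d./2%:Z))%:~R); first exact: ce_int.
rewrite !intrM intrB !natrM natrD natrM -![(Posz _)%:~R]/(_%:R).
by field.
Qed.

(** The characteristic [(0, k / p)] becomes [(k g, k d / p)]; its first entry is an integer because
    [p] divides the lower left entry, so [kl_nat] removes it. *)
Lemma Pi_trans (a b : int) (g d : nat) t : coprime d p -> odd d ->
  a * d%:Z - b * (p * g)%N%:Z = 1 -> 0 < complex.Im t ->
  ((p * g)%:R * t + d%:R) ^+ M * Pi 1 (mob a b (p * g)%N d t) = Pi d t.
Proof.
move=> dp od det t0.
set J := (p * g)%:R * t + d%:R.
have -> : J ^+ M = \prod_(k < M) J by rewrite prodr_const card_ord.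
rewrite /Pi -big_split /= -[RHS]mul1r -[X in _ = X * _](multiplier_eq1 g od) -big_split /=; apply: eq_bigr => k _.
have := kl_SL2 0 (k.+1%:R / p%:R) det t0.
rewrite !mul0r !add0r kl_def !mul0r ce0 mul1r add0r.
have -> : (k.+1%:R / p%:R)%:C = k.+1%:R * 1%:R / p%:R :> C.
  by rewrite mulr1 rmorphM fmorphV !rmorph_nat.
have pr : (p%:R : R) != 0 by rewrite pnatr_eq0 pM.
have -> : k.+1%:R / p%:R * ((p * g)%:Z)%:~R = (k.+1 * g)%:R :> R.
  by rewrite -pmulrn !natrM mulrA divfK.
rewrite (kl_nat _ _ t0).
have -> : (k.+1%:R / p%:R * (d%:Z)%:~R)%:C = k.+1%:R * d%:R / p%:R :> C.
  by rewrite !rmorphM fmorphV rmorph_int !rmorph_nat -[(d%:Z)%:~R]/(d%:R : C); field.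
by move=> ->.
Qed.

(* [eta (p^2 t) / eta t] *)
Definition Lq t : C := ce t ^+ s * (Ep 1 (ce (p%:R * (p%:R * t))) / Ep 1 (ce t)).

Lemma Im_pM t : 0 < complex.Im t -> 0 < complex.Im (p%:R * t).
Proof. by move=> t0; rewrite -(rmorph_nat (real_complex R)) Im_realM mulr_gt0// ltr0n pM. Qed.

(** The factors at [p t] cancel, and [Ep 1 (ce t)] is left with exponent [24 s - p^2 = -1]. *)
Lemma LqE t : 0 < complex.Im t ->
  cprod 1 ^+ p.+1 * Lq t = Pi 1 (p%:R * t) * Pi 1 t ^+ p * Delta t ^+ s.
Proof.
move=> t0; have t1 := Im_pM t0.
rewrite (PiE (coprime1n p) t0) (PiE (coprime1n p) t1) /Lq Delta_def.
have E0 := Ep1_neq0 (nrm_ce_lt1 t0); have E10 := Ep1_neq0 (nrm_ce_lt1 t1).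
set E2 := Ep 1 (ce (p%:R * (p%:R * t))); set E1 := Ep 1 (ce (p%:R * t)) in E10 *.
set E := Ep 1 (ce t) in E0 *; set c := cprod 1; set q := ce t.
clearbody E2 E1 E c q.
rewrite [(c * _) ^+ p]exprMn expr_div_n [(q * _) ^+ s]exprMn -!exprM ps addn1 !exprS.
move: (E1 ^+ p) (expf_neq0 p E10) (E ^+ (24 * s)) (expf_neq0 (24 * s) E0) (c ^+ p) (q ^+ s).
by move=> X X0 Y Y0 c' q'; field; rewrite E0 X0 Y0.
Qed.

(* The half system of residues mod [p] is permuted up to the sign [cprod d / cprod 1],
   which enters [p + 1] times and so cancels. *)
Lemma Lq_trans (a b : int) (d : nat) t : coprime d p -> odd d ->
  a * d%:Z - b * (p * p)%N%:Z = 1 -> 0 < complex.Im t ->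
  Lq (mob a b (p * p)%N d t) = Lq t.
Proof.
move=> dp od det t0; have t1 := Im_pM t0.
have t2 := Im_mob det t0.
(* The matrix [(a, b p; p, d)] acts on [p t] as the given one acts on [t], so [Pi_trans] applies
   twice: with [g = p] at [t] and with [g = 1] at [p t]. *)
have det' : a * d%:Z - (b * p%:Z) * (p * 1)%N%:Z = 1 by rewrite -det; nia.
have h1 := Pi_trans dp od det t0.
have h2 := Pi_trans dp od det' t1.
have h3 := Delta_SL2 det t0.
have mobE : mob a (b * p%:Z) (p * 1)%N d (p%:R * t) = p%:R * mob a b (p * p)%N d t.
  rewrite /mob muln1 -!pmulrn intrM natrM -pmulrn !mulrA; congr (_ / _).
  by ring.
have pp : p%:R * (p%:R * t) = (p * p)%:R * t by rewrite natrM mulrA.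
rewrite {}mobE muln1 pp in h2.
have e1 := PiE dp t0; have e2 := PiE dp t1.
have e3 := PiE (coprime1n p) t0; have e4 := PiE (coprime1n p) t1.
have J0 := cocycle_neq0 det t0; rewrite -!pmulrn in J0 h3.
have l1 := LqE t0; have l2 := LqE t2.
have cc : cprod d ^+ 2 = cprod 1 ^+ 2 by rewrite !cprod_sqr// coprime1n.
have aux (J P P' D c c' X Y : C) : J != 0 -> c' ^+ 2 = c ^+ 2 ->
    J ^+ M * P = c' * X -> J ^+ M * P' = c' * Y ->
    P' * P ^+ p * (J ^+ 12 * D) ^+ s = c * Y * (c * X) ^+ p * D ^+ s.
  move=> Jn0 hc hP hP'; apply: (mulfI (expf_neq0 p.+1 (expf_neq0 M Jn0))).
  have -> : (J ^+ M) ^+ p.+1 * (P' * P ^+ p * (J ^+ 12 * D) ^+ s) =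
      (J ^+ M * P') * (J ^+ M * P) ^+ p * (J ^+ 12 * D) ^+ s by rewrite exprS !exprMn; ring.
  rewrite hP hP' [(J ^+ 12 * D) ^+ s]exprMn -!exprM.
  (* The weights balance: [M] for each of the [p + 1] values of [Pi], 12 for each of the [s]
     discriminants. *)
  have -> : (12 * s = M * p.+1)%N by rewrite pM; nia.
  have cp : c' * c' ^+ p = c * c ^+ p.
    by rewrite -!exprS (_ : p.+1 = 2 * M.+1)%N ?exprM ?hc//; rewrite pM; lia.
  rewrite !exprMn.
  have -> : c' * Y * (c' ^+ p * X ^+ p) * (J ^+ (M * p.+1) * D ^+ s) =
    (c' * c' ^+ p) * (Y * X ^+ p * (J ^+ (M * p.+1) * D ^+ s)) by ring.
  by rewrite cp; ring.
have fin (J P P' D D' c c' X Y Q Q' S S' L L' : C) : c != 0 -> J != 0 -> c' ^+ 2 = c ^+ 2 ->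
    J ^+ M * P = S -> J ^+ M * P' = S' -> D' = J ^+ 12 * D -> S = c' * X -> S' = c' * Y ->
    Q = c * X -> Q' = c * Y -> c ^+ p.+1 * L = Q' * Q ^+ p * D ^+ s ->
    c ^+ p.+1 * L' = P' * P ^+ p * D' ^+ s -> L' = L.
  move=> cn0 Jn0 hc hP hP' -> hS hS' hQ hQ' hL hL'; apply: (mulfI (expf_neq0 p.+1 cn0)).
  by rewrite hL hL' hQ hQ'; apply: aux hc _ _ => //; rewrite ?hP ?hP'.
exact: fin (cprod_neq0 (coprime1n p)) J0 cc h1 h2 h3 e1 e2 e3 e4 l1 l2.
Qed.

(* [q^s (q^{p^2}; q^{p^2})_oo C(x, q)] with [q = e^{2 pi i t}]: its terms with exponent
   [m] modulo [p] make up [K_C p x m (p t)]. *)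
Definition Hx x t : C := ce t ^+ s * Ep 1 (ce (p%:R * (p%:R * t))) *
  (Ep 1 (ce t) / (Ep x (ce t) * Ep x^-1 (ce t))).

Lemma sn_dp_neq0 d : coprime d p -> (1 < p)%N -> sn (d%:R / p%:R : C) != 0.
Proof.
move=> dp p1; apply/eqP => /sn_eq0 [n hn].
have /eqP : (d%:Z)%:~R = (n * p%:Z)%:~R :> C by rewrite intrM -hn -!pmulrn divfK.
rewrite eqr_int => /eqP hd.
have : (p %| d)%N by apply/dvdnP; exists `|n|%N; nia.
move=> pd; move: dp; rewrite coprime_sym /coprime => /eqP.
by rewrite (gcdn_idPl pd) => p1'; rewrite p1' in p1.
Qed.

Lemma HxE d t : coprime d p -> (1 < p)%N -> 0 < complex.Im t ->
  Hx (ce (d%:R / p%:R)) t = sn (d%:R / p%:R) * Lq t / phi (d%:R / p%:R) t.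
Proof.
move=> dp p1 t0; have E0 := Ep1_neq0 (nrm_ce_lt1 t0); have s0 := sn_dp_neq0 dp p1.
rewrite /Hx /Lq phi_def -ceN.
have aux (q F E B S : C) : E != 0 -> S != 0 ->
   q * F * (E / B) = S * (q * (F / E)) / (S * (B / E ^+ 2)).
  move=> En0 S0; rewrite [(S * (B / E ^+ 2))^-1]invfM [(B / E ^+ 2)^-1]invfM invrK.
  by move: (B^-1) => b; field; rewrite S0 En0.
exact: aux.
Qed.

Lemma Hx_trans (a b : int) (d : nat) t : coprime d p -> (1 < p)%N -> odd d ->
  a * d%:Z - b * (p * p)%N%:Z = 1 -> 0 < complex.Im t ->
  Hx (ce (1%:R / p%:R)) (mob a b (p * p)%N d t) =
  ((p * p)%:R * t + d%:R) * (sn (1%:R / p%:R) / sn (d%:R / p%:R)) * Hx (ce (d%:R / p%:R)) t.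
Proof.
move=> dp p1 od det t0.
rewrite !HxE ?coprime1n ?Im_mob// (Lq_trans dp od det t0).
have pr : (p%:R : R) != 0 by rewrite pnatr_eq0 pM.
have := kl_SL2 0 (1%:R / p%:R) det t0.
rewrite !mul0r !add0r kl_def !mul0r ce0 mul1r add0r.
have -> : (1%:R / p%:R)%:C = 1%:R / p%:R :> C by rewrite rmorphM fmorphV !rmorph_nat.
have -> : 1%:R / p%:R * ((p * p)%:Z)%:~R = p%:R :> R.
  by rewrite -pmulrn natrM mulrA divfK// mul1r.
rewrite (kl_nat _ _ t0).
have -> : (1%:R / p%:R * (d%:Z)%:~R)%:C = d%:R / p%:R :> C.
  by rewrite !rmorphM fmorphV rmorph_int !rmorph_nat -pmulrn mul1r mulrC.
(* The [p] quasi-periods contribute (-1)^p e^{-pi i d}, which is 1 because [p] and [d] are odd. *)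
have -> : (-1) ^+ p * ce (- (p%:R * (d%:R / p%:R) / 2)) = 1 :> C.
  have -> : - (p%:R * (d%:R / p%:R) / 2) = - (d%:R * 2^-1) :> C by field.
  rewrite ceN ceMn ce_half -signr_odd -[(-1) ^+ d]signr_odd od pM /= odd_double /=.
  by rewrite divff// oppr_eq0 oner_eq0.
have J0 := cocycle_neq0 det t0; have s0 := sn_dp_neq0 dp p1.
rewrite -!pmulrn mul1r in J0 *.
have aux (J P P' S S' L : C) : J != 0 -> S' != 0 -> J * P = P' ->
   S * L / P = J * (S / S') * (S' * L / P').
  by move=> Jn0 S0 <-; rewrite [(J * P)^-1]invfM; move: (P^-1) => ip; field; rewrite S0 Jn0.
move=> h; rewrite mul1r in h; exact: aux J0 s0 h.
Qed.

End LevelP.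

(** * Dissection of the series modulo p *)

Lemma sum_multiples (V : zmodType) (p K : nat) (h : nat -> V) : (0 < p)%N ->
  \sum_(u < p * K) (if (p %| u)%N then h u else 0) = \sum_(i < K) h (p * i)%N.
Proof.
move=> p0; elim: K => [|K IH]; first by rewrite muln0 !big_ord0.
rewrite mulnS addnC big_split_ord /= IH big_ord_recr /=; congr (_ + _).
rewrite (bigD1 (Ordinal p0)) //= addn0 dvdn_mulr// big1 ?addr0// => v vn0.
by rewrite dvdn_addr ?dvdn_mulr// gtnNdvd// lt0n.
Qed.

Lemma sum_shift (V : zmodType) (K T : nat) (g : int -> V) : (T <= K)%N ->
  (forall n : nat, g (Negz n) = 0) ->
  \sum_(u < K) g (u%:Z - T%:Z) = \sum_(n < K - T) g n%:Z.
Proof.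
move=> TK g0; rewrite -(big_mkord xpredT (fun u : nat => g (u%:Z - T%:Z))).
rewrite (big_cat_nat (leq0n T) TK) /= [X in X + _]big_nat_cond big1 ?add0r; last first.
  move=> u /andP[/andP[_ uT] _]; have -> : u%:Z - T%:Z = Negz (T - u).-1 by lia.
  exact: g0.
rewrite -{1}(add0n T) big_addn big_mkord; apply: eq_bigr => n _.
by congr g; lia.
Qed.

Lemma sum_periodic (V : zmodType) (p : nat) (g : int -> V) (A B : int) : prime p ->
  ~~ (p%:Z %| A)%Z -> (forall i, g (i + p%:Z) = g i) ->
  \sum_(j < p) g j%:Z = \sum_(i < p) g (A * i%:Z + B).
Proof.
move=> pp pA gp; have p0 := prime_gt0 pp.
have gpn (n : nat) i : g (i + n%:Z * p%:Z) = g i.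
  elim: n => [|n IH]; first by rewrite mul0r addr0.
  by rewrite -[RHS]IH -[RHS]gp; congr g; lia.
have gmul (n : int) i : g (i + n * p%:Z) = g i.
  case: n => n; first exact: gpn.
  by rewrite -(gpn n.+1 (i + Negz n * p%:Z)); congr g; rewrite NegzE; lia.
pose r (i : 'I_p) : int := ((A * i%:Z + B) %% p%:Z)%Z.
have r0 i : 0 <= r i by apply: modz_ge0; lia.
have rp i : (`|r i| < p)%N by have := @ltz_pmod (A * i%:Z + B) p%:Z; have := r0 i; rewrite -/(r i); lia.
pose f i : 'I_p := Ordinal (rp i).
have finj : injective f.
  move=> i i' /(congr1 val) /= h.
  have {}h : r i = r i' by have := r0 i; have := r0 i'; lia.
  have : (p%:Z %| A * (i%:Z - i'%:Z))%Z.
    have -> : A * (i%:Z - i'%:Z) = (A * i%:Z + B) - (A * i'%:Z + B) by ring.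
    by rewrite -eqz_mod_dvd; apply/eqP.
  rewrite dvdzE abszM Euclid_dvdM// => /orP[|].
    by move=> h1; case/negP: pA.
  move=> h1; apply/val_inj => /=; have := ltn_ord i; have := ltn_ord i' => l1 l2.
  have : `|(i%:Z - i'%:Z)%R|%N = 0%N.
    apply/eqP; apply: contraTT h1; rewrite -lt0n => h0; rewrite gtnNdvd//; lia.
  lia.
rewrite (reindex_inj finj) /=; apply: eq_bigr => i _.
have -> : (`|r i|%N : int) = r i by have := r0 i; lia.
rewrite -(gmul (divz (A * i%:Z + B) p%:Z)); congr g.
by rewrite addrC /r -divz_eq.
Qed.

Section KFormula.
Variable R : realType.
Local Notation C := R[i].
Implicit Types (x z t : C).
Local Opaque ce sn Ep phi.

Lemma eta_prodE p z : (0 < p)%N -> 0 < complex.Im z ->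
  eta_prod p z = Ep 1 (ce (p%:R * z)).
Proof.
move=> p0 z0; apply: limC_ccvg.
have t0 : 0 < complex.Im (p%:R * z).
  by rewrite -(rmorph_nat (real_complex R)) Im_realM mulr_gt0// ltr0n.
apply: ccvg_ext (Ep_ccvg (nrm_ce_lt1 t0) 1) => N.
rewrite big_add1 /= big_mkord; apply: eq_bigr => n _.
by rewrite mul1r qpowE rmorph_nat natrM -mulrA mulrCA -ceMn.
Qed.

Lemma unity_filter p (e : int) : (0 < p)%N ->
  p%:R^-1 * \sum_(j < p) ce (e%:~R / p%:R) ^+ j = (if (p%:Z %| e)%Z then 1 else 0) :> C.
Proof.
move=> p0; have pn : (p%:R : C) != 0 by rewrite pnatr_eq0 -lt0n.
case: ifP => [/dvdzP [n ->]|pe].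
  rewrite intrM -pmulrn mulfK// ce_int.
  under eq_bigr do rewrite expr1n.
  by rewrite sumr_const card_ord mulVf.
set y := ce _.
have yp : y ^+ p = 1 by rewrite /y -ceMn mulrC divfK// ce_int.
have y1 : y - 1 != 0.
  rewrite subr_eq0; apply: contraFneq pe => /ce_eq1 [n hn].
  have /eqP : e%:~R = (n * p%:Z)%:~R :> C by rewrite intrM -hn -pmulrn divfK.
  by rewrite eqr_int => /eqP ->; rewrite dvdz_mull.
have := subrX1 y p; rewrite yp subrr => /esym/eqP; rewrite mulf_eq0 (negbTE y1) /=.
by move=> /eqP ->; rewrite mulr0.
Qed.

Lemma Hx_T (p s : nat) x t (n : int) : Hx p s x (t + n%:~R) = Hx p s x t.
Proof.
rewrite /Hx ceDint.
have -> : p%:R * (p%:R * (t + n%:~R)) = p%:R * (p%:R * t) + (p%:Z * (p%:Z * n))%:~R :> C.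
  by rewrite !intrM -!pmulrn; ring.
by rewrite ceDint.
Qed.

(** At [(z + j) / p] the term of exponent [n + s] carries the phase e^{2 pi i j (n + s) / p}, so the
    weighted mean over [j] keeps exactly the exponents congruent to [m]. The eta factor takes the
    same value for all [j]. *)
Lemma K_C_formula (p m : nat) x z : (1 < p)%N -> nrm x = 1 -> 0 < complex.Im z ->
  K_C p x m%:Z z = p%:R^-1 * \sum_(j < p)
    ce (- (m%:R * j%:R / p%:R)) * Hx p (s_p p) x ((z + j%:R) / p%:R).
Proof.
move=> p1 x1 z0; set s := s_p p; have p0 : (0 < p)%N by exact: ltnW.
have pn : (p%:R : C) != 0 by rewrite pnatr_eq0 -lt0n.
pose w (j : nat) := (z + j%:R) / p%:R.
have w0 j : 0 < complex.Im (w j).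
  have -> : complex.Im (w j) = (p%:R^-1) * complex.Im z.
    rewrite /w mulrC; have -> : (p%:R : C)^-1 = (p%:R^-1)%:C by rewrite fmorphV rmorph_nat.
    by rewrite Im_realM cImD -(rmorph_nat (real_complex R)) addr0.
  by rewrite mulr_gt0// invr_gt0 ltr0n.
have q1 j := nrm_ce_lt1 (w0 j).
pose gf j := Ep 1 (ce (w j)) / (Ep x (ce (w j)) * Ep x^-1 (ce (w j))).
pose S := p%:R^-1 * \sum_(j < p) ce (- (m%:R * j%:R / p%:R)) * ce (w j) ^+ s * gf j.
pose G (n : int) : C := crank_coef x n * ce ((n + s%:Z)%:~R * z / p%:R).
have FS : ccvg (fun N => \sum_(n < N) (if (p%:Z %| n%:Z + s%:Z - m%:Z)%Z then G n%:Z else 0)) S.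
  have h := ccvgM (ccvg_cst (p%:R^-1)) (@ccvg_sum R p
    (fun j N => ce (- (m%:R * j%:R / p%:R)) * ce (w j) ^+ s * \sum_(n < N) crank_coef x n%:Z * ce (w j) ^+ n)
    (fun j => ce (- (m%:R * j%:R / p%:R)) * ce (w j) ^+ s * gf j)
    (fun j => ccvgM (ccvg_cst _) (crank_series x1 (q1 j)))).
  apply: ccvg_ext h => N.
  under eq_bigr do rewrite mulr_sumr.
  rewrite exchange_big mulr_sumr /=; apply: eq_bigr => n _.
  have -> : (if (p%:Z %| n%:Z + s%:Z - m%:Z)%Z then G n%:Z else 0) =
     G n%:Z * (if (p%:Z %| n%:Z + s%:Z - m%:Z)%Z then 1 else 0).
    by case: ifP; rewrite ?mulr1 ?mulr0.
  rewrite -unity_filter// [RHS]mulrCA; congr (_ * _); rewrite mulr_sumr; apply: eq_bigr => j _.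
  rewrite /G -!ceMn -[RHS]mulrA -ceD -ceD [LHS]mulrCA -ceD; congr (_ * ce _).
  by rewrite /w intrB !intrD -!pmulrn; field.
rewrite /K_C eta_prodE//.
have -> : qpow ((m%:Z)%:~R / p%:R) z = ce (m%:R * z / p%:R).
  rewrite qpowE; congr ce; rewrite rmorphM fmorphV rmorph_int rmorph_nat -pmulrn.
  by rewrite mulrAC.
set e := ce (m%:R * z / p%:R).
have e0 : e != 0 by apply: ce_neq0.
have KS : K_series p x m%:Z z = S / e.
  apply: limC_ccvg; rewrite /=.
  (* The window [-N..N] corresponds to the multiples [u = p i] below [p (2 N + 1)], and [u - T N] is
     the index of the crank coefficient. The truncated subtraction is exact once [m <= p N + s]. *)
  pose T N := (p * N + s - m)%N.
  (* The [maxn] ensures [N <= f N] for every [N]; for large [N] the second argument is the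
     larger. *)
  pose f N := maxn N (p * (2 * N).+1 - T N)%N.
  have fN N : (N <= f N)%N by apply: leq_maxl.
  have h := ccvgM (ccvg_sub fN FS) (ccvg_cst e^-1).
  apply: (@ccvg_ev R _ _ _ (s + m)) h => N hN.
  have mT : (m <= p * N + s)%N by nia.
  have TN : (T N <= p * (2 * N).+1)%N by rewrite /T; nia.
  have -> : f N = (p * (2 * N).+1 - T N)%N by rewrite /f; apply/maxn_idPr; rewrite /T; nia.
  apply: (canLR (mulfK e0)).
  rewrite -(@sum_shift _ _ _ (fun n : int => if (p%:Z %| n + s%:Z - m%:Z)%Z then G n else 0))//; last first.
    by move=> n; rewrite /G /= mul0r if_same.
  rewrite mulr_suml.
  rewrite (eq_bigr (fun u : 'I_(p * (2 * N).+1) => if (p %| u)%N then G (u%:Z - (T N)%:Z) else 0)); last first.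
    move=> u _; have -> : u%:Z - (T N)%:Z + s%:Z - m%:Z = u%:Z - p%:Z * N%:Z by rewrite /T; lia.
    by rewrite rpredBr ?dvdz_mulr.
  rewrite (@sum_multiples _ p (2 * N).+1 (fun u => G (u%:Z - (T N)%:Z)))//.
  apply: eq_bigr => i _; rewrite /G.
  have -> : (p * i)%:Z - (T N)%:Z = p%:Z * (i%:Z - N%:Z) + m%:Z - s%:Z by rewrite /T; lia.
  rewrite -[RHS]mulrA; congr (_ * _); rewrite qpowE /e -ceD; congr ce.
  rewrite (rmorph_int (real_complex R)) subrK !intrD !intrM !intrD !mulrNz -!pmulrn.
  by field.
have HxS (j : nat) : Hx p s x (w j) = Ep 1 (ce (p%:R * z)) * (ce (w j) ^+ s * gf j).
  rewrite /Hx /gf.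
  have -> : p%:R * (p%:R * w j) = p%:R * z + (p%:Z * j%:Z)%:~R :> C.
    by rewrite /w intrM -!pmulrn; field.
  by rewrite ceDint -[LHS]mulrA [LHS]mulrCA.
rewrite KS [X in _ = _ * X](eq_bigr (fun j : 'I_p => Ep 1 (ce (p%:R * z)) *
   (ce (- (m%:R * j%:R / p%:R)) * ce (w j) ^+ s * gf j))); last first.
  by move=> j _; rewrite HxS [LHS]mulrCA; congr (_ * _); rewrite mulrA.
rewrite -mulr_sumr /S; move: (Ep 1 _) (\sum_(j < p) _) => E X.
by clearbody e; field; rewrite e0 pn.
Qed.

End KFormula.

(** With [p = 6n + 1] or [6n + 5], [p^2 - 1] is 12 times [n (3n + 1)] or [(n + 1) (3n + 2)], both
    even; so the division in [s_p] is exact. *)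
Lemma prime_sqr24 p : prime p -> (3 < p)%N -> (p * p = 24 * s_p p + 1)%N.
Proof.
move=> pp p3.
have p2 : ~~ (2 %| p)%N by rewrite dvdn_prime2//; lia.
have p3' : ~~ (3 %| p)%N by rewrite dvdn_prime2//; lia.
have [k hk] : exists k, (p * p = 24 * k + 1)%N.
  have [n [hn|hn]] : exists n, (p = 6 * n + 1)%N \/ (p = 6 * n + 5)%N.
    by exists (p %/ 6)%N; lia.
  - have [l hl] : exists l, (n * (3 * n + 1) = 2 * l)%N.
      have ev : ~~ odd (n * (3 * n + 1)) by rewrite oddM oddD oddM /=; case: odd.
      by exists (n * (3 * n + 1))./2; rewrite mul2n halfK (negbTE ev) subn0.
    exists l; nia.
  - have [l hl] : exists l, ((n + 1) * (3 * n + 2) = 2 * l)%N.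
      have ev : ~~ odd ((n + 1) * (3 * n + 2)) by rewrite !(oddM, oddD) /=; case: odd.
      by exists ((n + 1) * (3 * n + 2))./2; rewrite mul2n halfK (negbTE ev) subn0.
    exists l; nia.
by rewrite /s_p -mulnn hk addnK mulKn.
Qed.

(** * Permutation of the points (z + j) / p, and conclusion *)

Section Final.
Variable R : realType.
Local Notation C := R[i].
Local Opaque ce sn Ep phi.

Lemma zetaE p : zeta R p = ce p%:R^-1.
Proof.
have -> : (p%:R : C)^-1 = (p%:R^-1)%:C by rewrite fmorphV rmorph_nat.
by rewrite ce_realE.
Qed.

Lemma sn_ratio p d : sn (1%:R / p%:R : C) / sn (d%:R / p%:R) =
  (sin (pi / p%:R) / sin (d%:R * pi / p%:R))%:C.
Proof.
have h (n : nat) : sn (n%:R / p%:R : C) = (sin (n%:R * pi / p%:R))%:C * (2 * 'i).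
  have -> : (n%:R / p%:R : C) = (n%:R / p%:R : R)%:C by rewrite rmorphM fmorphV !rmorph_nat.
  rewrite sn_real rmorphM rmorph_nat mulrAC mulrC; congr ((sin _)%:C * _).
  by rewrite mulrCA mulrA.
have i0 : (2 * 'i : C) != 0.
  by rewrite mulf_neq0 ?pnatr_eq0// -nrm_eq0 /nrm /= expr0n add0r expr1n sqrtr1 oner_eq0.
rewrite !h mul1r -mulf_div divff// mulr1 rmorphM fmorphV //.
Qed.

End Final.

Section Coset.
Variable R : realType.
Local Notation C := R[i].
Local Opaque ce sn Ep phi.

(** Put [j = a^2 i - a k] and [w = (z - e) / p] with [e = - i] modulo [p]. A matrix with bottom row
    [(p^2, d + p e)] sends [w] to [(A z + j) / p], and [w] differs from [(z + i) / p] by the integer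
    [f]. *)
Lemma Hx_coset (p a d i : nat) (k : int) (z : C) : prime p -> (3 < p)%N -> (i < p)%N ->
  (1 <= d <= p.-1)%N -> a%:Z * d%:Z - k * p%:Z = 1 -> 0 < complex.Im z ->
  Hx p (s_p p) (ce (1%:R / p%:R)) ((mob a%:Z k p%:Z d%:Z z +
     (a%:Z ^+ 2 * i%:Z - a%:Z * k)%:~R) / p%:R) =
  (p%:R * z + d%:R) * ((-1) ^+ d.+1 * (sn (1%:R / p%:R) / sn (d%:R / p%:R))) *
  Hx p (s_p p) (ce (d%:R / p%:R)) ((z + i%:R) / p%:R).
Proof.
move=> pp p3 ip /andP[d1 dp] det z0.
have podd : odd p by case: (even_prime pp) => // p2; rewrite p2 in p3.
have pM : p = (p./2).*2.+1 by rewrite -[LHS]odd_double_half podd.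
have ps := prime_sqr24 pp p3.
have p1 := prime_gt1 pp; have p0 := prime_gt0 pp.
have pn : (p%:R : C) != 0 by rewrite pnatr_eq0 -lt0n.
(* Adding [p] to [e] changes the parity of [d + p e], since [p] is odd. *)
have [f [e [fE oe]]] : exists f e : nat, (i + e = p * f)%N /\ odd (d + p * e).
  case o : (odd (d + p * (p - i))).
    by exists 1%N, (p - i)%N; split; [lia|rewrite o].
  exists 2%N, (2 * p - i)%N; split; first lia.
  move: o; rewrite !oddD !oddM podd /= !oddB ?oddM /= ?podd; [by case: odd; case: odd|lia|lia].
set j : int := a%:Z ^+ 2 * i%:Z - a%:Z * k.
pose al : int := a%:Z + p%:Z * j.
pose be : int := a%:Z * f%:Z + a%:Z * i%:Z * k - k ^+ 2 + e%:Z * j.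
(* The requirement on the image of [w] forces this equation for [be]; its right side is divisible by
   [p] thanks to the choice of [j] and the determinant of [A]. *)
have pbe : p%:Z * be = k + j * d%:Z + e%:Z * al.
  have gen (A I E F P D K : int) : A * D - K * P = 1 -> I + E = P * F ->
      P * (A * F + A * I * K - K ^+ 2 + E * (A ^+ 2 * I - A * K)) =
      K + (A ^+ 2 * I - A * K) * D + E * (A + P * (A ^+ 2 * I - A * K)).
    move=> h1 h2; have -> : E = P * F - I by rewrite -h2; ring.
    have {}h1 : A * D = 1 + K * P by rewrite -h1; ring.
    have -> : (A ^+ 2 * I - A * K) * D = (A * I - K) * (A * D) by ring.
    by rewrite h1; ring.
  by apply: gen => //; lia.
have det2 : al * (d + p * e)%N%:Z - be * (p * p)%N%:Z = 1.
  rewrite -[RHS]det.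
  have -> : be * (p * p)%N%:Z = p%:Z * (p%:Z * be) by rewrite PoszM; ring.
  by rewrite pbe /al PoszD PoszM; ring.
pose w : C := (z - e%:R) / p%:R.
have w0 : 0 < complex.Im w.
  have -> : complex.Im w = (p%:R^-1) * complex.Im z.
    rewrite /w mulrC; have -> : (p%:R : C)^-1 = (p%:R^-1)%:C by rewrite fmorphV rmorph_nat.
    by rewrite Im_realM cImD cImN -(rmorph_nat (real_complex R)) /= oppr0 addr0.
  by rewrite mulr_gt0// invr_gt0 ltr0n.
have cop : coprime (d + p * e) p.
  rewrite coprime_sym prime_coprime// dvdn_addl ?dvdn_mulr// gtnNdvd//; lia.
have H := Hx_trans pM ps cop p1 oe det2 w0.
have J0 : p%:R * z + d%:R != 0 :> C.
  have := @cocycle_neq0 R a%:Z k p%:Z d%:Z z det z0; by rewrite -!pmulrn.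
have jE : (p * p)%:R * w + (d + p * e)%:R = p%:R * z + d%:R.
  by rewrite /w !natrM natrD natrM; field.
have mobE : mob al be (p * p)%N (d + p * e)%N w = (mob a%:Z k p%:Z d%:Z z + j%:~R) / p%:R.
  have pbe' : p%:R * be%:~R = k%:~R + j%:~R * d%:R + e%:R * al%:~R :> C.
    have -> : p%:R * be%:~R = (p%:Z * be)%:~R :> C by rewrite intrM -pmulrn.
    by rewrite pbe intrD intrD [(j * _)%:~R]intrM [(_ * al)%:~R]intrM -!pmulrn.
  rewrite /mob -!pmulrn jE.
  have -> : al%:~R * w + be%:~R = (al%:~R * z + k%:~R + j%:~R * d%:R) / p%:R :> C.
    apply: (mulfI pn); rewrite mulrDr pbe' /w; field.
    by [].
  rewrite /al intrD intrM -!pmulrn; move: J0; set X := p%:R * z + d%:R => J0.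
  have -> : (a%:R + p%:R * j%:~R) * z + k%:~R + j%:~R * d%:R = a%:R * z + k%:~R + j%:~R * X.
    by rewrite /X; ring.
  by clearbody X; field; rewrite J0 pn.
rewrite mobE jE in H; rewrite H.
(* As [d + p e] is odd, [e] and [d + 1] have the same parity; this is the sign of the theorem. *)
have snE2 : sn ((d + p * e)%:R / p%:R : C) = (-1) ^+ d.+1 * sn (d%:R / p%:R).
  have -> : (d + p * e)%:R / p%:R = d%:R / p%:R + (e%:Z)%:~R :> C.
    by rewrite natrD natrM -pmulrn; field.
  rewrite snDint; congr (_ * _).
  rewrite -[LHS]/((-1) ^+ e) -[LHS]signr_odd -[RHS]signr_odd; congr (_ ^+ _).
  by move: oe; rewrite oddD oddM podd /=; case: (odd d); case: (odd e).
have ceE : ce ((d + p * e)%:R / p%:R : C) = ce (d%:R / p%:R).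
  have -> : (d + p * e)%:R / p%:R = d%:R / p%:R + (e%:Z)%:~R :> C.
    by rewrite natrD natrM -pmulrn; field.
  exact: ceDint.
have HE x : Hx p (s_p p) x w = Hx p (s_p p) x ((z + i%:R) / p%:R).
  rewrite -(Hx_T p (s_p p) x w f%:Z); congr (Hx _ _ _ _); rewrite /w.
  have fE' : (i%:R + e%:R : C) = p%:R * f%:R by rewrite -natrD fE natrM.
  have -> : e%:R = p%:R * f%:R - i%:R :> C by rewrite -fE'; ring.
  by rewrite -pmulrn; field.
rewrite snE2 ceE HE invfM.
have -> : ((-1) ^+ d.+1 : C)^-1 = (-1) ^+ d.+1 by rewrite -signr_odd; case: odd; rewrite ?expr1 ?expr0 ?invrN ?invr1.
by congr (_ * _ * _); ring.
Qed.

End Coset.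

Local Opaque ce sn Ep phi Hx.

Theorem theorem3p1 (R : realType) (p : nat) (m a d : nat) (k : int) :
  prime p -> (3 < p)%N -> (m <= p.-1)%N ->
  (1 <= a <= p.-1)%N -> (1 <= d <= p.-1)%N ->
  a%:Z * d%:Z - k * p%:Z = 1 ->
  forall z : R[i], 0 < complex.Im z ->
  slash1 (K_C p (zeta R p) m%:Z) a%:Z k p%:Z d%:Z z =
    ((sin (pi / p%:R) / sin (d%:R * pi / p%:R)) * (-1) ^+ d.+1)%:C
    * zeta R p ^ (m%:Z * a%:Z * k)
    * K_C p (zeta R p ^+ d) (m * a ^ 2)%N%:Z z.
Proof.
move=> pp p3 mp /andP[a1 ap] hd det z z0.
have p1 := prime_gt1 pp; have p0 := prime_gt0 pp.
have pn : (p%:R : R[i]) != 0 by rewrite pnatr_eq0 -lt0n.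
have pE n : n%:R / p%:R = (n%:R / p%:R)%:C :> R[i] by rewrite rmorphM fmorphV !rmorph_nat.
have nce n : nrm (ce (n%:R / p%:R : R[i])) = 1 by rewrite pE nrm_ce_real.
have z1 : zeta R p = ce (1%:R / p%:R) by rewrite zetaE div1r.
have zd : zeta R p ^+ d = ce (d%:R / p%:R) by rewrite zetaE -ceMn.
have zk : zeta R p ^ (m%:Z * a%:Z * k) = ce (m%:R * a%:R * k%:~R / p%:R).
  by rewrite zetaE -ceMz !intrM -!pmulrn.
have J0 : p%:R * z + d%:R != 0.
  by have := cocycle_neq0 det z0; rewrite -!pmulrn.
have w0 := Im_mob det z0.
(* The summand of the dissection at [A z], extended to all integers so that its period [p] permits
   reindexing. *)
pose g (n : int) : R[i] := ce (- (m%:R * n%:~R / p%:R)) *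
  Hx p (s_p p) (ce (1%:R / p%:R)) ((mob a%:Z k p%:Z d%:Z z + n%:~R) / p%:R).
have gp n : g (n + p%:Z) = g n.
  rewrite /g intrD -pmulrn.
  have -> : - (m%:R * (n%:~R + p%:R) / p%:R) = - (m%:R * n%:~R / p%:R) + (- m%:Z)%:~R :> R[i].
    by rewrite mulrNz -pmulrn; field.
  rewrite ceDint; set w := mob _ _ _ _ z.
  have -> : (w + (n%:~R + p%:R)) / p%:R = (w + n%:~R) / p%:R + 1%:~R by field.
  by rewrite Hx_T.
(* As [a ^ 2] is invertible modulo [p], the shift [a^2 i - a k] runs over all residues with [i]. *)
have pa : ~~ (p%:Z %| a%:Z ^+ 2)%Z.
  by rewrite dvdzE abszX /= Euclid_dvdX// andbT gtnNdvd//; lia.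
have K1 : K_C p (ce (1%:R / p%:R)) m%:Z (mob a%:Z k p%:Z d%:Z z) =
    p%:R^-1 * \sum_(j < p) g j%:Z.
  by rewrite (K_C_formula m p1 (nce 1%N) w0).
rewrite (@sum_periodic _ p g (a%:Z ^+ 2) (- (a%:Z * k)) pp pa gp) in K1.
have K2 := K_C_formula (m * a ^ 2) p1 (nce d) z0.
pose c : R[i] := (-1) ^+ d.+1 * (sn (1%:R / p%:R) / sn (d%:R / p%:R)).
pose e : R[i] := ce (m%:R * a%:R * k%:~R / p%:R).
pose h (i : nat) : R[i] := ce (- ((m * a ^ 2)%:R * i%:R / p%:R)) *
  Hx p (s_p p) (ce (d%:R / p%:R)) ((z + i%:R) / p%:R).
have gE (i : 'I_p) : g (a%:Z ^+ 2 * i%:Z - a%:Z * k) = (p%:R * z + d%:R) * (c * e) * h i.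
  rewrite /g (Hx_coset pp p3 (ltn_ord i) hd det z0) -/c /h.
  (* The phase of [j = a^2 i - a k] splits into the constant [zeta^(mak)] and the phase that filters
     the residue [m a^2]. *)
  have -> : ce (- (m%:R * (a%:Z ^+ 2 * i%:Z - a%:Z * k)%:~R / p%:R)) =
      e * ce (- ((m * a ^ 2)%:R * i%:R / p%:R)).
    rewrite /e -ceD; congr ce; rewrite intrB !intrM -!pmulrn natrM natrX.
    by field.
  by move: (Hx _ _ _ _) (ce _) => X Y; ring.
rewrite (eq_bigr (fun i : 'I_p => (p%:R * z + d%:R) * (c * e) * h i)) in K1; last by move=> i _.
rewrite -mulr_sumr in K1.
have fin (J q S E F x y K K' : R[i]) : J != 0 -> K = q * (J * (x * y) * S) -> K' = q * S ->
    E = x -> F = y -> J^-1 * K = E * F * K'.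
  by move=> Jn0 -> -> -> ->; field.
rewrite zk zd z1 /slash1 -!pmulrn; apply: fin J0 K1 K2 _ (erefl _).
have sE : ((-1) ^+ d.+1 : R)%:C = (-1) ^+ d.+1 :> R[i] by exact: rmorph_sign.
by rewrite rmorphM /= sE -sn_ratio mulrC.
Qed.
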